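(* Let $1\le r,s<\infty$ and let $0<p<\infty$ satisfy $\frac1p=\frac1r+\frac1s$. Let $X$ be a pointed metric space, $E$ a Banach space and $T:X\to E$ a Lipschitz operator. The following properties are equivalent: (1) $T$ is strictly Lipschitz $(p,r,s)$-summing. (2) There exist a Banach space $G$, a strictly Lipschitz $r$-summing operator $R:X\to G$ and a Cohen strongly $s^*$-summing linear operator $S:G\to E$ (where $1/s+1/s^*=1$) such that $T=S\circ R$.
   Context: The scalar field is $\mathbb K=\mathbb R$. A pointed metric space $X$ has a distinguished point $0$. A Lipschitz operator $T:X\to E$ is a Lipschitz map with $T(0)=0$. $X^{\#}$ is the Banach space of Lipschitz functions $f:X\to\mathbb R$ with $f(0)=0$, normed by the Lipschitz constant; $B_{X^{\#}}$ is its closed unit ball. For $x,y\in X$, $\delta_{(x,y)}\in (X^{\#})^*$ is $\delta_{(x,y)}(f)=f(x)-f(y)$; $\mathcal F(X)$ is the closed linear span of all $\delta_{(x,y)}$ in $(X^{\#})^*$, and $\mathcal F(X)^*=X^{\#}$ isometrically. $q^*$ is the conjugate exponent of $q\in[1,\infty]$. For a finite sequence in a Banach space $E$: $\|(e_i)\|_{l_q^n(E)}=(\sum_i\|e_i\|^q)^{1/q}$ and $\|(e_i)\|_{l_q^{n,w}(E)}=\sup_{e^*\in B_{E^*}}(\sum_i|\langle e_i,e^*\rangle|^q)^{1/q}$ (maxima when $q=\infty$). For $1\le q\le\infty$, a bounded linear operator $S:G\to E$ is Cohen strongly $q$-summing if there is $C>0$ with $\sum_{i=1}^n|\langle S(x_i),y_i^*\rangle|\le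 C\|(x_i)\|_{l_q^n(G)}\|(y_i^* )\|_{l_{q^*}^{n,w}(E^* )}$ for all $n$, $x_i\in G$, $y_i^*\in E^*$. $T:X\to E$ is strictly Lipschitz $(p,r,s)$-summing if there is $C>0$ such that for all $n_1,n_2\in\mathbb N^*$, all $x_i^j,y_i^j\in X$, $\lambda_i^j\in\mathbb K$ and $e_i^*\in E^*$ ($1\le i\le n_1$, $1\le j\le n_2$), $$\Big(\sum_{i=1}^{n_1}\Big|\Big\langle\sum_{j=1}^{n_2}\lambda_i^j(T(x_i^j)-T(y_i^j)),e_i^*\Big\rangle\Big|^p\Big)^{1/p}\le C\sup_{f\in B_{X^{\#}}}\Big(\sum_{i=1}^{n_1}\Big|\sum_{j=1}^{n_2}\lambda_i^j(f(x_i^j)-f(y_i^j))\Big|^r\Big)^{1/r}\|(e_i^* )\|_{l_s^{n_1,w}(E^* )}.$$ $X\boxtimes G^*$ (Lipschitz tensor product) is the span of the functionals $\delta_{(x,y)}\boxtimes g^*: f\mapsto\langle f(x)-f(y),g^*\rangle$ on the space $Lip_0(X;G^{**})$ of Lipschitz maps $X\to G^{**}$ vanishing at $0$. For $1\le q\le\infty$ and $u=\sum_{k=1}^l\delta_{(x_k,y_k)}\boxtimes s_k^*\in X\boxtimes G^*$ put $d_q^L(u)=\inf\{\|(m_i)\|_{l_q^{n,w}(\mathcal F(X))}\|(g_i^* )\|_{l_{q^*}^n(G^* )}\}$, the infimum over all $n$, $m_i\in\mathcal F(X)$, $g_i^*\in G^*$ with $\sum_{i=1}^n m_i\otimes g_i^*=\sum_{k=1}^l\delta_{(x_k,y_k)}\otimes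 s_k^*$ in $\mathcal F(X)\otimes G^*$. A Lipschitz operator $R:X\to G$ is strictly Lipschitz $q$-summing if there is $C>0$ such that for all $l$, $x_k,y_k\in X$, $s_k^*\in G^*$, $\big|\sum_{k=1}^l\langle R(x_k)-R(y_k),s_k^*\rangle\big|\le C\,d_q^L(u)$ with $u=\sum_{k=1}^l\delta_{(x_k,y_k)}\boxtimes s_k^*$. *)

(* Defs.v *)
From HB Require Import structures.
From mathcomp Require Import all_boot all_order all_algebra.
From mathcomp Require Import all_classical all_reals all_analysis.

Set Implicit Arguments.
Unset Strict Implicit.
Unset Printing Implicit Defensive.

Import Order.TTheory GRing.Theory Num.Def Num.Theory.
Import numFieldNormedType.Exports.

Local Open Scope classical_set_scope.
Local Open Scope ring_scope.

(* R as a normed space over itself *)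
Definition scalars (R : realType) : normedModType R :=
  NormedModule.clone R R^o _.

(* [best_const a w v] is the least constant K >= 0 with a i v <= K * w i for
   all i. Lipschitz constants and operator norms are both of this form. *)
Section best_const.
Context {R : realType} {V : lmodType R} {I : Type}.
Variables (a : I -> V -> R) (w : I -> R).

Definition best_const (v : V) : R :=
  inf [set K | 0 <= K /\ forall i, a i v <= K * w i].

Hypothesis w_ge0 : forall i, 0 <= w i.
Hypothesis a_ge0 : forall i v, 0 <= a i v.
Hypothesis aD : forall i u v, a i (u + v) <= a i u + a i v.
Hypothesis aZ : forall i k v, a i (k *: v) = `|k| * a i v.
Hypothesis a_bnd : forall v, exists K, forall i, a i v <= K * w i.

Let S v := [set K | 0 <= K /\ forall i, a i v <= K * w i].

Let S_has_inf v : has_inf (S v).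
Proof.
split; last by exists 0 => K [].
have [K HK] := a_bnd v; exists `|K|; split=> // i.
by rewrite (le_trans (HK i))// ler_wpM2r// ler_norm.
Qed.

Lemma best_const_ge0 v : 0 <= best_const v.
Proof. by apply: lb_le_inf => [|K []//]; case: (S_has_inf v). Qed.

Lemma best_const_le v K : 0 <= K -> (forall i, a i v <= K * w i) ->
  best_const v <= K.
Proof. by move=> K0 HK; apply: ge_inf => //; case: (S_has_inf v). Qed.

Lemma best_constP v i : a i v <= best_const v * w i.
Proof.
have := w_ge0 i; rewrite le_eqVlt => /orP[/eqP w0|w_gt0].
  by have [K /(_ i)] := a_bnd v; rewrite -w0 !mulr0.
rewrite -ler_pdivrMr//; apply: lb_le_inf; first by case: (S_has_inf v).
by move=> K [_ /(_ i)]; rewrite ler_pdivrMr.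
Qed.

Lemma best_constD u v : best_const (u + v) <= best_const u + best_const v.
Proof.
apply: best_const_le => [|i]; first by rewrite addr_ge0// best_const_ge0.
by rewrite (le_trans (aD _ _ _))// mulrDl lerD// best_constP.
Qed.

Let best_constZ_le k v : best_const (k *: v) <= `|k| * best_const v.
Proof.
apply: best_const_le => [|i]; first by rewrite mulr_ge0// best_const_ge0.
by rewrite aZ -mulrA ler_wpM2l// best_constP.
Qed.

Lemma best_constZ k v : best_const (k *: v) = `|k| * best_const v.
Proof.
apply/eqP; rewrite eq_le best_constZ_le/=.
have [->|k0] := eqVneq k 0; first by rewrite normr0 mul0r best_const_ge0.
rewrite -[X in _ * best_const X]scale1r -(mulVf k0) -scalerA.
rewrite (le_trans (ler_wpM2l _ (best_constZ_le _ _)))//.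
by rewrite mulrA normfV divff ?mul1r// normr_eq0.
Qed.

Lemma best_const0P v : best_const v = 0 -> forall i, a i v = 0.
Proof.
move=> v0 i; apply/eqP; rewrite eq_le a_ge0 andbT.
by rewrite (le_trans (best_constP v i))// v0 mul0r.
Qed.

End best_const.

Section lip0.
Context {R : realType} {X : metricType R} (x0 : X) (E : normedModType R).

Definition lip0_pred : {pred X -> E} := fun f => `[< f x0 = 0 /\
  exists K : R, forall x y, `|f x - f y| <= K * mdist x y >].

Lemma lip0_submod_closed : submod_closed lip0_pred.
Proof.
split.
  apply/asboolP; split=> //; exists 0 => x y.
  by rewrite subrr normr0 mul0r.
move=> k f g /asboolP[f0 [K HK]] /asboolP[g0 [L HL]]; apply/asboolP; split.
  by rewrite !fctE f0 g0 scaler0 addr0.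
exists (`|k| * K + L) => x y; rewrite !fctE.
rewrite opprD addrACA -scalerBr (le_trans (ler_normD _ _))//.
by rewrite mulrDl lerD// normrZ -mulrA ler_wpM2l.
Qed.

HB.instance Definition _ :=
  GRing.isSubmodClosed.Build R (X -> E) lip0_pred lip0_submod_closed.

Record lip0 := Lip0 { lip0_fun :> X -> E; lip0P : lip0_fun \in lip0_pred }.

HB.instance Definition _ := [isSub for lip0_fun].
HB.instance Definition _ := [Choice of lip0 by <:].
HB.instance Definition _ := [SubChoice_isSubLmodule of lip0 by <:].

Lemma lip0_bnd (f : lip0) :
  exists K : R, forall x y, `|f x - f y| <= K * mdist x y.
Proof. by have /asboolP[] := lip0P f. Qed.

Definition lip0_norm : lip0 -> R :=
  best_const (fun xy (f : lip0) => `|f xy.1 - f xy.2|)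
             (fun xy => mdist xy.1 xy.2).

Let bnd (f : lip0) :
  exists K : R, forall xy : X * X, `|f xy.1 - f xy.2| <= K * mdist xy.1 xy.2.
Proof. by have [K HK] := lip0_bnd f; exists K => -[]. Qed.

Let aD (xy : X * X) (f g : lip0) : `|(f + g) xy.1 - (f + g) xy.2| <=
  `|f xy.1 - f xy.2| + `|g xy.1 - g xy.2|.
Proof. by rewrite /= opprD addrACA ler_normD. Qed.

Let aZ (xy : X * X) k (f : lip0) :
  `|(k *: f) xy.1 - (k *: f) xy.2| = `|k| * `|f xy.1 - f xy.2|.
Proof. by rewrite /= -scalerBr normrZ. Qed.

Let w0 (xy : X * X) : 0 <= mdist xy.1 xy.2 :> R. Proof. exact: mdist_ge0. Qed.

Lemma lip0_normD f g : lip0_norm (f + g) <= lip0_norm f + lip0_norm g.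
Proof. exact: best_constD. Qed.

Lemma lip0_normZ k f : lip0_norm (k *: f) = `|k| * lip0_norm f.
Proof. exact: best_constZ. Qed.

Lemma lip0_norm0_eq0 f : lip0_norm f = 0 -> f = 0.
Proof.
move=> f0; apply/val_inj/funext => x /=; apply/eqP.
have /asboolP[fx0 _] := lip0P f; rewrite -[f x]subr0 -fx0 -normr_eq0.
by apply/eqP; apply: (best_const0P _ _ _ f0 (x, x0)).
Qed.

HB.instance Definition _ :=
  Lmodule_isNormed.Build R lip0 lip0_normD lip0_normZ lip0_norm0_eq0.

Lemma lip0_normP (f : lip0) x y : `|f x - f y| <= `|f| * mdist x y.
Proof.
exact: (best_constP (a := fun xy (f : lip0) => `|f xy.1 - f xy.2|)
  w0 bnd f (x, y)).
Qed.

End lip0.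

(* X^# *)
Definition lipdual {R : realType} {X : metricType R} (x0 : X) :
    normedModType R :=
  NormedModule.clone R (lip0 x0 (scalars R)) _.

Section blin.
Context {R : realType} (V W : normedModType R).

Definition blin_pred : {pred V -> W} := fun f => `[< linear f /\
  exists K : R, forall x, `|f x| <= K * `|x| >].

Lemma blin_submod_closed : submod_closed blin_pred.
Proof.
split.
  apply/asboolP; split=> [k u v|]; first by rewrite /= scaler0 addr0.
  by exists 0 => x; rewrite normr0 mul0r.
move=> k f g /asboolP[lf [K HK]] /asboolP[lg [L HL]]; apply/asboolP; split.
  move=> c u v; rewrite !fctE lf lg !scalerDr !scalerA addrACA.
  by rewrite [k * c]mulrC.
exists (`|k| * K + L) => x; rewrite !fctE (le_trans (ler_normD _ _))//.
by rewrite mulrDl lerD// normrZ -mulrA ler_wpM2l.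
Qed.

HB.instance Definition _ :=
  GRing.isSubmodClosed.Build R (V -> W) blin_pred blin_submod_closed.

Record blin := Blin { blin_fun :> V -> W; blinP : blin_fun \in blin_pred }.

HB.instance Definition _ := [isSub for blin_fun].
HB.instance Definition _ := [Choice of blin by <:].
HB.instance Definition _ := [SubChoice_isSubLmodule of blin by <:].

Lemma blin_linear (f : blin) : linear f.
Proof. by have /asboolP[] := blinP f. Qed.

HB.instance Definition _ (f : blin) :=
  GRing.isLinear.Build R V W *:%R (blin_fun f) (blin_linear f).

Lemma blin_bnd (f : blin) : exists K : R, forall x, `|f x| <= K * `|x|.
Proof. by have /asboolP[] := blinP f. Qed.

Definition blin_norm : blin -> R :=
  best_const (fun x (f : blin) => `|f x|) (fun x : V => `|x|).

Let aD (x : V) (f g : blin) : `|(f + g) x| <= `|f x| + `|g x|.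
Proof. exact: ler_normD. Qed.

Let aZ (x : V) k (f : blin) : `|(k *: f) x| = `|k| * `|f x|.
Proof. exact: normrZ. Qed.

Let w0 (x : V) : 0 <= `|x|. Proof. exact: normr_ge0. Qed.

Lemma blin_normD f g : blin_norm (f + g) <= blin_norm f + blin_norm g.
Proof. exact: best_constD w0 aD blin_bnd f g. Qed.

Lemma blin_normZ k f : blin_norm (k *: f) = `|k| * blin_norm f.
Proof. exact: best_constZ w0 aZ blin_bnd k f. Qed.

Lemma blin_norm0_eq0 f : blin_norm f = 0 -> f = 0.
Proof.
move=> f0; apply/val_inj/funext => x /=; apply/eqP; rewrite -normr_eq0.
apply/eqP; apply: (best_const0P (a := fun x (f : blin) => `|f x|) w0 _ _ f0 x).
  by move=> *; exact: normr_ge0.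
exact: blin_bnd.
Qed.

HB.instance Definition _ :=
  Lmodule_isNormed.Build R blin blin_normD blin_normZ blin_norm0_eq0.

Lemma blin_normP (f : blin) x : `|f x| <= `|f| * `|x|.
Proof.
exact: (best_constP (a := fun x (f : blin) => `|f x|) w0 blin_bnd f x).
Qed.

End blin.

Definition dual {R : realType} (V : normedModType R) : normedModType R :=
  NormedModule.clone R (blin V (scalars R)) _.

Section closed_span.
Context {R : realType} {V : normedModType R} (A : set V).

Definition lspan : set V := [set v | exists n (k : 'I_n -> R) (u : 'I_n -> V),
  (forall i, A (u i)) /\ v = \sum_(i < n) k i *: u i].

Definition cspan_pred : {pred V} := fun v => `[< closure lspan v >].

Let lspanD u v : lspan u -> lspan v -> lspan (u + v).
Proof.
move=> [n [k [a [Aa ->]]]] [m [l [b [Ab ->]]]].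
exists (n + m)%N, (fun i : 'I_(n + m) => match fintype.split i with inl j => k j | inr j => l j end),
  (fun i : 'I_(n + m) => match fintype.split i with inl j => a j | inr j => b j end); split.
  by move=> i; case: (fintype.split i).
rewrite big_split_ord/=; congr +%R; apply: eq_bigr => i _.
  by rewrite (unsplitK (inl i)).
by rewrite (unsplitK (inr i)).
Qed.

Let lspanZ c v : lspan v -> lspan (c *: v).
Proof.
move=> [n [k [a [Aa ->]]]]; exists n, (fun i => c * k i), a; split=> //.
by rewrite scaler_sumr; apply: eq_bigr => i _; rewrite scalerA.
Qed.

Let closureP v : closure lspan v <->
  forall e : R, 0 < e -> exists2 u, lspan u & `|v - u| < e.
Proof.
split=> [cv e e0|Hv B /nbhs_ballP[e /= e0 eB]].
  have [u [Su]] := cv _ (nbhsx_ballx v e e0).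
  by rewrite -ball_normE /= => vu; exists u.
have [u Su vu] := Hv e e0; exists u; split=> //; apply: eB.
by rewrite -ball_normE.
Qed.

Lemma cspan_submod_closed : submod_closed cspan_pred.
Proof.
split.
  apply/asboolP/subset_closure; exists 0%N, (fun=> 0), (fun=> 0).
  by split=> [[]//|]; rewrite big_ord0.
move=> c u v /asboolP/closureP Hu /asboolP/closureP Hv.
apply/asboolP/closureP => e e0.
have c1 : 0 < `|c| + 1 by rewrite ltr_wpDl.
have [u' Su' uu'] := Hu (e / 2 / (`|c| + 1)) ltac:(by rewrite !divr_gt0).
have [v' Sv' vv'] := Hv (e / 2) ltac:(by rewrite divr_gt0).
exists (c *: u' + v'); first exact/lspanD/Sv'/lspanZ.
rewrite opprD addrACA -scalerBr (le_lt_trans (ler_normD _ _))//.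
rewrite [ltRHS]splitr ler_ltD// normrZ.
rewrite (@le_trans _ _ ((`|c| + 1) * `|u - u'|))//.
  by rewrite ler_wpM2r// lerDl.
by rewrite mulrC -ler_pdivlMr// ltW.
Qed.

HB.instance Definition _ :=
  GRing.isSubmodClosed.Build R V cspan_pred cspan_submod_closed.

Record cspan := CSpan { cspan_val :> V; cspanP : cspan_val \in cspan_pred }.

HB.instance Definition _ := [isSub for cspan_val].
HB.instance Definition _ := [Choice of cspan by <:].
HB.instance Definition _ := [SubChoice_isSubLmodule of cspan by <:].

HB.instance Definition _ := GRing.isLinear.Build R cspan V *:%R cspan_val
  (fun k u v => erefl).

Let cspan_norm (v : cspan) : R := `|cspan_val v|.

Let cspan_normD u v : cspan_norm (u + v) <= cspan_norm u + cspan_norm v.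
Proof. exact: ler_normD. Qed.

Let cspan_normZ k v : cspan_norm (k *: v) = `|k| * cspan_norm v.
Proof. exact: normrZ. Qed.

Let cspan_norm0_eq0 v : cspan_norm v = 0 -> v = 0.
Proof. by move=> /normr0_eq0 v0; exact/val_inj. Qed.

HB.instance Definition _ :=
  Lmodule_isNormed.Build R cspan cspan_normD cspan_normZ cspan_norm0_eq0.

Lemma cspan_mem v : A v -> v \in cspan_pred.
Proof.
move=> Av; apply/asboolP/subset_closure; exists 1%N, (fun=> 1), (fun=> v).
by split=> //; rewrite big_ord1 scale1r.
Qed.

End closed_span.

Section free_space.
Context {R : realType} {X : metricType R} (x0 : X).

Definition delta_fun (x y : X) : lipdual x0 -> R^o := fun f => f x - f y.

Lemma delta_subproof x y :
  delta_fun x y \in @blin_pred R (lipdual x0) (scalars R).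
Proof.
apply/asboolP; split=> [k f g|].
  by rewrite /delta_fun /= opprD addrACA -scalerBr.
by exists (mdist x y) => f; rewrite mulrC lip0_normP.
Qed.

Definition delta x y : dual (lipdual x0) := Blin (delta_subproof x y).

Definition free_space : normedModType R :=
  NormedModule.clone R (cspan [set m | exists x y, m = delta x y]) _.

Definition free_delta x y : free_space :=
  CSpan (cspan_mem (ex_intro _ x (ex_intro _ y erefl))).

End free_space.


(* Ryan's model of the algebraic tensor product: v (x) w is the functional
   B |-> B v w on the space of bilinear forms on V x W, so an identity between
   sums of elementary tensors in V (x) W is an identity of functionals. *)
Definition tens {R : realType} {V W : lmodType R} (v : V) (w : W) :
  {bilinear V -> W -> R^o} -> R^o := fun B => B v w.

(* the functional f |-> <f x - f y, g> on Lip_0(X; dual (dual G)) *)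
Definition lip_tens {R : realType} {X : metricType R} {x0 : X}
    {G : normedModType R} (x y : X) (g : dual G) :
  lip0 x0 (dual (dual G)) -> R^o := fun f => (f x - f y) g.

Section lip_tens_free_tens.
Context {R : realType}.

Let tens_separated (V W : lmodType R) (H : Type) (ev : H -> {linear V -> R^o}) :
  (forall v, (forall h, ev h v = 0) -> v = 0) ->
  forall (B : {bilinear V -> W -> R^o}) n (v : 'I_n -> V) (w : 'I_n -> W),
  (forall h, \sum_(i < n) ev h (v i) *: w i = 0) ->
  \sum_(i < n) B (v i) (w i) = 0.
Proof.
move=> sep B; elim=> [|n IH] v w Hvw; first by rewrite big_ord0.
have [v0|] := pselect (v ord0 = 0).
  rewrite big_ord_recl v0 linear0l add0r; apply: IH => h.
  by have := Hvw h; rewrite big_ord_recl v0 linear0 scale0r add0r.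
move=> /(contra_not (@sep _))/existsNP[h /eqP hv0].
pose c i := ev h (v (lift ord0 i)) / ev h (v ord0).
have w0E : w ord0 = - \sum_(i < n) c i *: w (lift ord0 i).
  apply: (scalerI hv0); rewrite scalerN scaler_sumr; apply/eqP.
  rewrite -subr_eq0 opprK -[X in _ == X](Hvw h) big_ord_recl; apply/eqP.
  congr +%R; apply: eq_bigr => i _.
  by rewrite scalerA /c mulrC mulfVK.
rewrite big_ord_recl w0E linearNr linear_sumr -sumrN -big_split/=.
have := IH (fun i => v (lift ord0 i) - c i *: v ord0)
           (fun i => w (lift ord0 i)).
move=> IH'; rewrite -[RHS]IH'; last first.
  move=> h'; rewrite -[RHS](Hvw h') big_ord_recl w0E scalerN scaler_sumr.
  rewrite -sumrN -big_split/=; apply: eq_bigr => i _.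
  rewrite linearB linearZ/= scalerBl addrC.
  by rewrite scalerA [ev h' _ * _]mulrC.
apply: eq_bigr => i _.
by rewrite linearBl linearZl linearZr/= addrC.
Qed.

Context {X : metricType R} {x0 : X} {G : normedModType R}.

Let ev_subproof (a : G) :
  (fun phi : dual G => phi a : R^o)
    \in @blin_pred R (dual G) (scalars R).
Proof.
apply/asboolP; split=> //; exists `|a| => phi.
by rewrite mulrC blin_normP.
Qed.

Let ev a : dual (dual G) := Blin (ev_subproof a).

Let rank1_subproof (h : lipdual x0) (a : G) :
  (fun x => h x *: ev a) \in @lip0_pred R X x0 (dual (dual G)).
Proof.
apply/asboolP; split.
  by have /asboolP[h0 _] := lip0P h; rewrite h0 scale0r.
exists (`|h| * `|ev a|) => x y.
by rewrite -scalerBl normrZ mulrAC ler_wpM2r// lip0_normP.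
Qed.

Lemma lip_tens_free_tens l (x y : 'I_l -> X) (g : 'I_l -> dual G)
    l' (x' y' : 'I_l' -> X) (g' : 'I_l' -> dual G) :
  \sum_(k < l) lip_tens (x0 := x0) (x k) (y k) (g k) =
    \sum_(k < l') lip_tens (x' k) (y' k) (g' k) ->
  \sum_(k < l) tens (free_delta x0 (x k) (y k)) (g k) =
    \sum_(k < l') tens (free_delta x0 (x' k) (y' k)) (g' k).
Proof.
move=> eqL; apply/funext => B; rewrite !fct_sumE; apply/eqP.
pose evf (h : lipdual x0) (m : free_space x0) : R^o := cspan_val m h.
have evf_lin h : linear (evf h).
  by move=> k m m'; rewrite /evf linearP.
pose evl h : {linear free_space x0 -> R^o} :=
  HB.pack (evf h) (GRing.isLinear.Build _ _ _ _ _ (evf_lin h)).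
pose v (k : 'I_(l + l')) := match fintype.split k with
  | inl i => free_delta x0 (x i) (y i)
  | inr i => free_delta x0 (x' i) (y' i) end.
pose w (k : 'I_(l + l')) := match fintype.split k with
  | inl i => g i | inr i => - g' i end.
have vl i : v (lshift l' i) = free_delta x0 (x i) (y i).
  by rewrite /v (unsplitK (inl i)).
have vr i : v (rshift l i) = free_delta x0 (x' i) (y' i).
  by rewrite /v (unsplitK (inr i)).
have wl i : w (lshift l' i) = g i by rewrite /w (unsplitK (inl i)).
have wr i : w (rshift l i) = - g' i by rewrite /w (unsplitK (inr i)).
have := @tens_separated _ _ _ evl _ B _ v w.
rewrite big_split_ord/=.
under eq_bigr do rewrite vl wl.
under [X in _ + X]eq_bigr do rewrite vr wr linearNr.
rewrite sumrN -subr_eq0 => ->//.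
  by move=> m m0; apply/val_inj/val_inj/funext.
move=> h; apply/val_inj/funext => a.
rewrite -[LHS]/(ev a _) linear_sum big_split_ord/=.
under eq_bigr do rewrite vl wl.
under [X in _ + X]eq_bigr do rewrite vr wr scalerN.
have /(congr1 (fun F => F (Lip0 (rank1_subproof h a)))) := eqL.
rewrite !fct_sumE => /eqP; rewrite -subr_eq0 => /eqP E.
rewrite -[RHS]E -sumrN; congr +%R; apply: eq_bigr => i _.
  by rewrite /lip_tens /= -scalerBl.
by rewrite /lip_tens /= -scalerBl.
Qed.

End lip_tens_free_tens.

Section summing.
Context {R : realType}.
Implicit Types (q : \bar R).

(* (sum_i |a_i|^q)^(1/q) for finite q > 0, max_i |a_i| for q = +oo *)
Definition lq q n (a : 'I_n -> R) : R :=
  match q with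
  | q%:E => (\sum_(i < n) `|a i| `^ q) `^ q^-1
  | +oo%E => \big[Num.max/0]_(i < n) `|a i|
  | -oo%E => 0
  end.

Definition strong_lq q {V : normedModType R} n (v : 'I_n -> V) : R :=
  lq q (fun i => `|v i|).

Definition weak_lq q {V : normedModType R} n (v : 'I_n -> V) : R :=
  sup [set lq q (fun i => phi (v i)) | phi in [set phi : dual V | `|phi| <= 1]].

Definition cohen_strongly_summing q {G E : normedModType R} (S : blin G E) :=
  exists2 C : R, 0 < C & forall n (x : 'I_n -> G) (ys : 'I_n -> dual E),
    \sum_(i < n) `|ys i (S (x i))| <=
      C * strong_lq q x * weak_lq (hoelder_conjugate q) ys.

Definition strictly_lipschitz_prs_summing (p r s : R) {X : metricType R}
    {x0 : X} {E : normedModType R} (T : lip0 x0 E) :=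
  exists2 C : R, 0 < C & forall (n1 n2 : nat), (0 < n1)%N -> (0 < n2)%N ->
    forall (x y : 'I_n1 -> 'I_n2 -> X) (lam : 'I_n1 -> 'I_n2 -> R)
           (es : 'I_n1 -> dual E),
    lq p%:E (fun i => es i (\sum_(j < n2) lam i j *: (T (x i j) - T (y i j))))
    <= C
      * sup [set lq r%:E (fun i => \sum_(j < n2) lam i j * (f (x i j) - f (y i j)))
            | f in [set f : lipdual x0 | `|f| <= 1]]
      * weak_lq s%:E es.

(* Meant for u in the span of the [lip_tens x y g]. By [lip_tens_free_tens],
   all representations of u give the same element of F(X) (x) G^*, so letting
   the representation vary does not change the infimum. *)
Definition dL q {X : metricType R} {x0 : X} {G : normedModType R}
    (u : lip0 x0 (dual (dual G)) -> R^o) : R :=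
  inf [set c | exists l (x y : 'I_l -> X) (gs : 'I_l -> dual G),
    u = \sum_(k < l) lip_tens (x k) (y k) (gs k) /\
    exists n (m : 'I_n -> free_space x0) (hs : 'I_n -> dual G),
      \sum_(i < n) tens (m i) (hs i) =
        \sum_(k < l) tens (free_delta x0 (x k) (y k)) (gs k) /\
      c = weak_lq q m * strong_lq (hoelder_conjugate q) hs].

Definition strictly_lipschitz_summing q {X : metricType R} {x0 : X}
    {G : normedModType R} (T : lip0 x0 G) :=
  exists2 C : R, 0 < C &
    forall l (x y : 'I_l -> X) (gs : 'I_l -> dual G),
    `|\sum_(k < l) gs k (T (x k) - T (y k))| <=
      C * dL q (x0 := x0) (\sum_(k < l) lip_tens (x k) (y k) (gs k)).

End summing.

(* Main.v *)
From HB Require Import structures.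
Require Import Defs.
From mathcomp Require Import all_boot all_order all_algebra.
From mathcomp Require Import all_classical all_reals all_analysis.
From mathcomp Require Import ring.

Set Implicit Arguments.
Unset Strict Implicit.
Unset Printing Implicit Defensive.

Import Order.TTheory GRing.Theory Num.Theory.
Import numFieldNormedType.Exports.

Local Open Scope classical_set_scope.
Local Open Scope ring_scope.

(* (1) => (2) is a Pietsch domination argument in which finitely additive means
   replace measures. By Young's inequality, the summing inequality says that no
   finite sum of the functions
     (f, phi) |-> p/r |m f|^r + p/s |phi e|^s - C^-p |m (e o T)|^p
   on B_{X^#} x B_{E^**} is bounded above by a negative constant, m ranging
   over the span of the delta_(x,y). By Hahn-Banach there is a mean M on the
   bounded functions that is nonnegative on all of them. With
   N1 m = M(|m|^r)^(1/r) and N2 e = M(|e|^s)^(1/s), homogeneity gives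
   |m (e o T)| <= C N1 m N2 e.
   The factoring space needs no completion: G is the set of v in E with
   |v|_G = sup_e |e v| / N2 e finite. It is complete because N2 <= |.|, R is T
   seen as a map into G, and S is the inclusion.
   (2) => (1) recovers (sum |R m_i|^r)^(1/r) and (sum |S^* e_i|^s)^(1/s) by
   duality with l_{r^*} and l_{s^*} and concludes with Hoelder's inequality. *)

(** * Finite l_q norms: Young, Hoelder, duality and Minkowski *)

Section finite_lq.
Context {R : realType}.
Implicit Types p q r s : R.

Lemma lq_ge0 (q : \bar R) n (a : 'I_n -> R) : 0 <= lq q a.
Proof.
case: q => [q||]//=; first exact: powR_ge0.
by elim/big_ind: _ => // x y x0 y0; rewrite le_max x0.
Qed.

Lemma lq_powR q n (a : 'I_n -> R) : 0 < q ->
  lq q%:E a `^ q = \sum_(i < n) `|a i| `^ q.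
Proof.
move=> q0; rewrite /= -powRrM mulVf ?gt_eqF// powRr1//.
by apply: sumr_ge0 => i _; exact: powR_ge0.
Qed.

Lemma lq_le q n (a : 'I_n -> R) K : 0 < q -> 0 <= K ->
  (lq q%:E a <= K) = (\sum_(i < n) `|a i| `^ q <= K `^ q).
Proof.
move=> q0 K0; rewrite -lq_powR//; apply/idP/idP => h.
  by apply: ge0_ler_powR; rewrite ?nnegrE ?lq_ge0// ltW.
rewrite leNgt; apply/negP => /(gt0_ltr_powR q0).
by rewrite !nnegrE lq_ge0 K0 => /(_ isT isT); rewrite ltNge h.
Qed.

Lemma lq_mono q n (a b : 'I_n -> R) : 0 < q -> (forall i, `|a i| <= `|b i|) ->
  lq q%:E a <= lq q%:E b.
Proof.
move=> q0 ab; rewrite lq_le ?lq_ge0// lq_powR//; apply: ler_sum => i _.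
by apply: ge0_ler_powR; rewrite ?nnegrE// ltW.
Qed.

Lemma lq_eq0 q n (a : 'I_n -> R) : 0 < q -> lq q%:E a = 0 -> forall i, a i = 0.
Proof.
move=> q0 a0 i; have := lq_powR a q0.
rewrite a0 powR0 ?gt_eqF// => /esym/psumr_eq0P h.
have /powR_eq0_eq0/normr0_eq0// := h (fun i _ => powR_ge0 _ _) i isT.
Qed.

(** Young's inequality for [x^p] and [y^p] with the conjugate exponents [r / p] and [s / p]. *)
Lemma young_powR p r s (x y : R) : 0 < p -> 0 < r -> 0 < s ->
  p^-1 = r^-1 + s^-1 -> 0 <= x -> 0 <= y ->
  (x * y) `^ p <= p / r * x `^ r + p / s * y `^ s.
Proof.
move=> p0 r0 s0 prs x0 y0; rewrite powRM//.
have := @conjugate_powR R (x `^ p) (y `^ p) (r / p) (s / p).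
rewrite !powR_ge0 !divr_gt0// !invf_div -mulrDr -prs divff ?gt_eqF//.
move=> /(_ isT isT isT isT erefl); rewrite -!powRrM.
rewrite [p * (r / p)]mulrC [p * (s / p)]mulrC !divfK ?gt_eqF//.
by rewrite (mulrC _ (p / r)) (mulrC _ (p / s)).
Qed.

(** When both norms are positive, normalize them to 1 and sum [young_powR] over the indices; the
    coefficients [p / r] and [p / s] add up to 1. This works for [p < 1] as well. A vanishing norm
    makes every product zero and is treated first. *)
Lemma lq_hoelder p r s n (a b : 'I_n -> R) : 0 < p -> 0 < r -> 0 < s ->
  p^-1 = r^-1 + s^-1 ->
  lq p%:E (fun i => a i * b i) <= lq r%:E a * lq s%:E b.
Proof.
move=> p0 r0 s0 prs; set A := lq _ a; set B := lq _ b.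
have zero (c : 'I_n -> R) K : 0 <= K -> (forall i, c i = 0) -> lq p%:E c <= K.
  move=> K0 c0; rewrite lq_le// big1 ?powR_ge0// => i _.
  by rewrite c0 normr0 powR0// gt_eqF.
have AB0 : 0 <= A * B by rewrite mulr_ge0 ?lq_ge0.
have [A0|A0] := eqVneq A 0.
  by apply: zero => // i; rewrite (lq_eq0 r0 A0) mul0r.
have [B0|B0] := eqVneq B 0.
  by apply: zero => // i; rewrite (lq_eq0 s0 B0) mulr0.
have {}A0 : 0 < A by rewrite lt_def A0 lq_ge0.
have {}B0 : 0 < B by rewrite lt_def B0 lq_ge0.
have rescale (x y c d : R) : 0 < c -> 0 < d -> x * y = (c * d) * ((x / c) * (y / d)).
  by move=> c0 d0; field; rewrite !gt_eqF.
have normalized q (c : 'I_n -> R) : 0 < q -> 0 < lq q%:E c ->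
    \sum_(i < n) (`|c i| / lq q%:E c) `^ q = 1.
  move=> q0 c0; under eq_bigr => i _.
    rewrite powRM ?invr_ge0 ?lq_ge0// -powR_inv1 ?lq_ge0//.
    rewrite powRAC powR_inv1 ?powR_ge0//.
    over.
  by rewrite -mulr_suml -lq_powR// divff// gt_eqF// powR_gt0.
have nA : \sum_(i < n) (`|a i| / A) `^ r = 1 := normalized r a r0 A0.
have nB : \sum_(i < n) (`|b i| / B) `^ s = 1 := normalized s b s0 B0.
clearbody A B.
rewrite lq_le//; apply: (@le_trans _ _ (\sum_(i < n) (A * B) `^ p *
    (p / r * (`|a i| / A) `^ r + p / s * (`|b i| / B) `^ s))).
  apply: ler_sum => i _.
  have -> : `|a i * b i| = (A * B) * ((`|a i| / A) * (`|b i| / B)).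
    by rewrite normrM; exact: rescale.
  rewrite powRM// ?ler_wpM2l ?powR_ge0//; last by rewrite mulr_ge0// divr_ge0// ltW.
  by apply: young_powR => //; rewrite divr_ge0// ltW.
rewrite -mulr_sumr big_split/= -!mulr_sumr nA nB !mulr1 -mulrDr -prs.
by rewrite divff ?gt_eqF// mulr1.
Qed.

Lemma hoelder_conjugate_fin r : 1 < r ->
  exists r', [/\ hoelder_conjugate r%:E = r'%:E, 0 < r', 1^-1 = r^-1 + r'^-1
    & (r - 1) * r' = r].
Proof.
move=> r1; have r0 : 0 < r by rewrite (lt_trans ltr01).
have r10 : 0 < r - 1 by rewrite subr_gt0.
exists (r / (r - 1)); split.
- rewrite /hoelder_conjugate/= gt_eqF// -EFinD.
  by rewrite inver gt_eqF.
- by rewrite divr_gt0.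
- by field; rewrite !gt_eqF.
- by field; rewrite gt_eqF.
Qed.

(** For [1 < r] this is [lq_hoelder] with [p = 1]. For [r = 1] the conjugate is [+oo] and each [b i]
    is bounded by the maximum. *)
Lemma lq_hoelder_conjugate r n (a b : 'I_n -> R) : 1 <= r ->
  \sum_(i < n) `|a i| * `|b i| <= lq r%:E a * lq (hoelder_conjugate r%:E) b.
Proof.
rewrite le_eqVlt => /predU1P[<-|r1].
  rewrite hoelder_conjugate1 /= invr1 powRr1; last first.
    by apply: sumr_ge0 => i _; exact: powR_ge0.
  rewrite mulr_suml; apply: ler_sum => i _; rewrite powRr1//.
  by rewrite ler_wpM2l// le_bigmax.
have [r' [-> r'0 rr' _]] := hoelder_conjugate_fin r1.
have := lq_hoelder a b ltr01 (lt_trans ltr01 r1) r'0 rr'; apply: le_trans.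
rewrite /= invr1 powRr1; last by apply: sumr_ge0 => i _; exact: powR_ge0.
by apply: ler_sum => i _; rewrite powRr1// normrM.
Qed.

(** The extremal test sequence is [a^(r-1)]: since [(r - 1) r' = r], both sums become [S], the sum
    of the [a_i^r], and dividing by [S^(1/r')] leaves [S^(1/r)]. For [r = 1] the test sequence is
    constantly 1. *)
Lemma lq_dual r n (a : 'I_n -> R) K : 1 <= r -> 0 <= K ->
  (forall i, 0 <= a i) ->
  (forall b : 'I_n -> R, (forall i, 0 <= b i) ->
     \sum_(i < n) a i * b i <= K * lq (hoelder_conjugate r%:E) b) ->
  lq r%:E a <= K.
Proof.
move=> r1 K0 a0 h; move: r1; rewrite le_eqVlt => /predU1P[r1|r1].
  rewrite -r1 hoelder_conjugate1 /= in h *; rewrite invr1 powRr1; last first.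
    by apply: sumr_ge0 => i _; exact: powR_ge0.
  have := h (fun=> 1) (fun=> ler01).
  under eq_bigr do rewrite mulr1.
  under [in leLHS]eq_bigr do rewrite -(ger0_norm (a0 _)).
  under [X in _ -> X <= _]eq_bigr do rewrite powRr1//.
  move=> /le_trans; apply; rewrite -[leRHS]mulr1 ler_wpM2l//.
  elim/big_ind: _ => [//|x y x1 y1|i _]; first by rewrite ge_max x1.
  by rewrite normr1.
have [r' [r'E r'0 rr' rr'M]] := hoelder_conjugate_fin r1.
have r0 : 0 < r by rewrite (lt_trans ltr01).
have := h (fun i => a i `^ (r - 1)) (fun i => powR_ge0 _ _).
rewrite r'E /=; set S := \sum_(i < n) `|a i| `^ r.
have -> : \sum_(i < n) a i * a i `^ (r - 1) = S.
  by apply: eq_bigr => i _; rewrite mulr_powRB1// ger0_norm.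
have -> : \sum_(i < n) `|a i `^ (r - 1)| `^ r' = S.
  by apply: eq_bigr => i _; rewrite norm_powR// -powRrM rr'M.
move=> hS.
have S0 : 0 <= S by apply: sumr_ge0 => i _; exact: powR_ge0.
have [->|Sn0] := eqVneq S 0; first by rewrite powR0 ?invr_eq0 ?gt_eqF.
have Sr'0 : 0 < S `^ r'^-1 by rewrite powR_gt0// lt_def Sn0.
rewrite -(ler_pM2r Sr'0); apply: le_trans hS.
by rewrite -powRD ?Sn0 ?implybT// -rr' invr1 powRr1.
Qed.

(** Minkowski's inequality by duality: a pairing of [|a| + |b|] with a test sequence splits into
    two, and Hoelder bounds each. *)
Lemma lqD r n (a b : 'I_n -> R) : 1 <= r ->
  lq r%:E (fun i => a i + b i) <= lq r%:E a + lq r%:E b.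
Proof.
move=> r1; have r0 : 0 < r by rewrite (lt_le_trans ltr01).
apply: (@le_trans _ _ (lq r%:E (fun i => `|a i| + `|b i|))).
  by apply: lq_mono => // i; rewrite [leRHS]ger0_norm ?addr_ge0// ler_normD.
apply: lq_dual => //; first by rewrite addr_ge0 ?lq_ge0.
move=> c c0; rewrite mulrDl.
under eq_bigr => i _ do rewrite mulrDl -[X in `|a i| * X](ger0_norm (c0 i))
  -[X in `|b i| * X](ger0_norm (c0 i)).
by rewrite big_split/= lerD// lq_hoelder_conjugate.
Qed.

Lemma lq_const_le r n (a : 'I_n -> R) e : 1 <= r -> 0 <= e ->
  (forall i, `|a i| <= e) -> lq r%:E a <= e * lq r%:E (fun _ : 'I_n => 1).
Proof.
move=> r1 e0 ae; have r0 : 0 < r by rewrite (lt_le_trans ltr01).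
rewrite lq_le// ?mulr_ge0 ?lq_ge0// powRM ?lq_ge0// lq_powR// mulr_sumr.
apply: ler_sum => i _; rewrite normr1 powR1 mulr1.
by apply: ge0_ler_powR; rewrite ?nnegrE// ltW.
Qed.

End finite_lq.

(** * Hahn-Banach with cone constraints, through minimal sublinear functionals *)

Section hahn_banach.
Context {R : realType}.

Definition sublinear (V : lmodType R) (q : V -> R) :=
  (forall u v, q (u + v) <= q u + q v) /\
  (forall (c : R) u, 0 < c -> q (c *: u) <= c * q u).

Section sublinear_theory.
Variable V : lmodType R.
Implicit Types (q : V -> R).

Lemma sublinearZ q c u : sublinear q -> 0 < c -> q (c *: u) = c * q u.
Proof.
move=> [_ qZ] c0; apply/eqP; rewrite eq_le qZ//=.
have := qZ c^-1 (c *: u); rewrite invr_gt0 scalerA mulVf ?gt_eqF// scale1r.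
by move=> /(_ c0); rewrite ler_pdivlMl.
Qed.

Lemma sublinear0 q : sublinear q -> q 0 = 0.
Proof.
move=> sq; have := sublinearZ 0 sq (ltr0n R 2); rewrite scaler0 => /eqP.
by rewrite -subr_eq0 mulr_natl mulr2n opprD addrA subrr add0r oppr_eq0 => /eqP.
Qed.

Lemma sublinear_geN q u : sublinear q -> - q (- u) <= q u.
Proof.
move=> sq; rewrite lerNl -subr_ge0 opprK; have := sq.1 (- u) u.
by rewrite addNr sublinear0.
Qed.

Definition conv_cone (S : V -> R -> Prop) :=
  [/\ S 0 0, forall h a h' a', S h a -> S h' a' -> S (h + h') (a + a')
    & forall c h a, 0 < c -> S h a -> S (c *: h) (c * a)].

(** Take [p w] as the infimum of [q (w + h) + a] over the pairs of [S]. The hypothesis on [S] makes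
    it finite, the pair [(0, 0)] gives [p <= q], and [w = - h] gives the last conclusion. *)
Lemma sublinear_cone q (S : V -> R -> Prop) : sublinear q -> conv_cone S ->
  (forall h a, S h a -> 0 <= q h + a) ->
  exists p : V -> R, [/\ sublinear p, forall u, p u <= q u
    & forall h a, S h a -> p (- h) <= a].
Proof.
move=> sq [S0 SD SZ] Sq.
pose A w := [set x | exists h a, S h a /\ x = q (w + h) + a].
have A_lb w : has_lbound (A w).
  exists (- q (- w)) => _ [h [a [Sha ->]]]; rewrite lerNl -subr_ge0 opprK.
  apply: le_trans (Sq _ _ Sha) _; rewrite addrA lerD2r.
  by apply: le_trans (sq.1 _ _); rewrite addKr.
have A_q w : A w (q w) by exists 0, 0; rewrite !addr0.
have A_inf w h a : S h a -> inf (A w) <= q (w + h) + a.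
  by move=> Sha; apply: ge_inf => //; exists h, a.
exists (fun w => inf (A w)); split.
- split=> [u v|c u c0].
    rewrite -lerBlDl; apply: lb_le_inf; first by exists (q v).
    move=> _ [h [a [Sha ->]]]; rewrite lerBlDl -lerBlDr.
    apply: lb_le_inf; first by exists (q u).
    move=> _ [h' [a' [Sha' ->]]]; rewrite lerBlDr.
    apply: le_trans (A_inf _ _ _ (SD _ _ _ _ Sha' Sha)) _.
    by rewrite [leRHS]addrACA lerD2r addrACA sq.1.
  rewrite -ler_pdivrMl//; apply: lb_le_inf; first by exists (q u).
  move=> _ [h [a [Sha ->]]]; rewrite ler_pdivrMl//.
  apply: le_trans (A_inf _ _ _ (SZ _ _ _ c0 Sha)) _.
  by rewrite mulrDr lerD2r -scalerDr sq.2.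
- by move=> u; exact: ge_inf.
- by move=> h a Sha; have := A_inf (- h) _ _ Sha; rewrite addNr sublinear0// add0r.
Qed.

(** Zorn's lemma for the reversed pointwise order below [q]; a chain is bounded by its pointwise
    infimum, which is finite because each member is at least [- q (- u)] at [u]. *)
Lemma minimal_sublinear q : sublinear q ->
  exists p : V -> R, [/\ sublinear p, forall u, p u <= q u
    & forall p' : V -> R, sublinear p' -> (forall u, p' u <= p u) -> p' = p].
Proof.
move=> sq.
pose P p := sublinear p /\ forall u, p u <= q u.
pose D := {p : V -> R | P p}.
pose le (x y : D) := `[< forall u, sval y u <= sval x u >].
have [||||[p [sp pq]] pmin] := @Zorn D le.
- by move=> x; apply/asboolP.
- move=> x y z /asboolP xy /asboolP yz; apply/asboolP => u.
  exact: le_trans (yz u) (xy u).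
- move=> [x Px] [y Py] /asboolP/= xy /asboolP/= yx; apply: eq_exist => /=.
  by apply/funext => u; apply/eqP; rewrite eq_le yx xy.
- move=> A Atot; have [[x0 Ax0]|A0] := pselect (A !=set0); last first.
    have Pq : P q by split.
    by exists (exist _ q Pq) => x Ax; case: A0; exists x.
  pose B u := [set sval x u | x in A].
  have B_lb u : has_lbound (B u).
    exists (- q (- u)) => _ [[x [sx xq]] _ <-] /=.
    by apply: le_trans (sublinear_geN u sx); rewrite lerN2.
  have B_inf u x : A x -> inf (B u) <= sval x u.
    by move=> Ax; apply: ge_inf => //; exists x.
  have Pinf : P (fun u => inf (B u)).
    split; last first.
      by move=> u; apply: le_trans (B_inf u _ Ax0) _; case: (x0) => ? [].
    split=> [u v|c u c0].
      rewrite -lerBlDl; apply: lb_le_inf; first by exists (sval x0 v), x0.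
      move=> _ [x Ax <-]; rewrite lerBlDl -lerBlDr.
      apply: lb_le_inf; first by exists (sval x0 u), x0.
      move=> _ [y Ay <-]; rewrite lerBlDr.
      (* The smaller of the two members serves for both [u] and [v], so the infimum is
         subadditive. *)
      have [/asboolP xy|/asboolP yx] := Atot _ _ Ax Ay.
        apply: le_trans (B_inf _ _ Ay) _.
        apply: le_trans ((svalP y).1.1 _ _) _.
        by rewrite lerD2l.
      apply: le_trans (B_inf _ _ Ax) _.
      apply: le_trans ((svalP x).1.1 _ _) _.
      by rewrite lerD2r.
    rewrite -ler_pdivrMl//; apply: lb_le_inf; first by exists (sval x0 u), x0.
    move=> _ [x Ax <-]; rewrite ler_pdivrMl//.
    by apply: le_trans (B_inf _ _ Ax) _; exact: (svalP x).1.2.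
  by exists (exist _ _ Pinf) => x Ax; apply/asboolP => u /=; exact: B_inf.
- exists p; split=> // p' sp' p'p.
  have Pp' : P p' by split=> // u; exact: le_trans (p'p u) (pq u).
  have /(congr1 sval) := pmin (exist _ p' Pp') (introT (asboolP _) p'p).
  exact.
Qed.

(* A pair (h, a) of S is the constraint - a <= f h. *)
Lemma hahn_banach q (S : V -> R -> Prop) : sublinear q -> conv_cone S ->
  (forall h a, S h a -> 0 <= q h + a) ->
  exists f : V -> R^o, [/\ linear f, forall u, f u <= q u
    & forall h a, S h a -> 0 <= f h + a].
Proof.
move=> sq cS Sq; have [q1 [sq1 q1q q1S]] := sublinear_cone sq cS Sq.
have [f [sf fq1 fmin]] := minimal_sublinear sq1.
(* A minimal [f] is odd: the ray generated by [(v, - f v)] yields a sublinear functional below [f]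
   whose value at [- v] is at most [- f v], and by minimality it is [f]. *)
have fN v : f (- v) = - f v.
  apply/eqP; rewrite eq_le; apply/andP; split; last first.
    by have := sublinear_geN (- v) sf; rewrite opprK.
  pose S' h a := exists2 t, 0 <= t & h = t *: v /\ a = - (t * f v).
  have cS' : conv_cone S'.
    split.
    - by exists 0; rewrite // scale0r mul0r oppr0.
    - move=> _ _ _ _ [t t0 [-> ->]] [t' t'0 [-> ->]]; exists (t + t').
        by rewrite addr_ge0.
      by rewrite scalerDl mulrDl opprD.
    - move=> c _ _ c0 [t t0 [-> ->]]; exists (c * t).
        by rewrite mulr_ge0// ltW.
      by rewrite scalerA mulrN mulrA.
  have [|f' [sf' f'f f'S']] := sublinear_cone sf cS'.
    move=> _ _ [t t0 [-> ->]]; move: t0; rewrite le_eqVlt => /predU1P[<-|t0].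
      by rewrite scale0r mul0r sublinear0// subr0.
    by rewrite sublinearZ// subrr.
  rewrite -(fmin _ sf' f'f); apply: f'S'; exists 1 => //.
  by rewrite scale1r mul1r (fmin _ sf' f'f).
(* Oddness turns subadditivity at [- u] and [- v] into superadditivity at [u] and [v]. *)
have fD u v : f (u + v) = f u + f v.
  apply/eqP; rewrite eq_le sf.1/= -[u + v]opprK fN opprD lerNr opprD -!fN.
  exact: sf.1.
exists f; split.
- move=> c u v; rewrite fD; congr +%R.
  have [c0|c0|->] := ltgtP c 0.
  + by rewrite -[c]opprK scaleNr fN (sublinearZ _ sf) ?oppr_gt0// scaleNr.
  + by rewrite sublinearZ.
  + by rewrite !scale0r sublinear0.
- by move=> u; exact: le_trans (fq1 u) (q1q u).
- move=> h a Sha; rewrite -[X in f X]opprK fN addrC subr_ge0.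
  exact: le_trans (fq1 _) (q1S _ _ Sha).
Qed.

End sublinear_theory.

Lemma blin_norm_le (V W : normedModType R) (f : blin V W) K : 0 <= K ->
  (forall x, `|f x| <= K * `|x|) -> `|f| <= K.
Proof.
move=> K0 HK.
exact: (best_const_le (a := fun x (f : blin V W) => `|f x|)
  (@normr_ge0 _ V) (@blin_bnd _ V W) K0 HK).
Qed.

Lemma lip0_norm_le (X : metricType R) (x0 : X) (E : normedModType R)
    (f : lip0 x0 E) K : 0 <= K ->
  (forall x y, `|f x - f y| <= K * mdist x y) -> `|f| <= K.
Proof.
move=> K0 HK; apply: (best_const_le
  (a := fun xy (f : lip0 x0 E) => `|f xy.1 - f xy.2|)
  (w := fun xy => mdist xy.1 xy.2) _ _ K0 (fun xy => HK xy.1 xy.2)) => [xy|g].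
  exact: mdist_ge0.
by have [L HL] := lip0_bnd g; exists L => -[].
Qed.

(** Hahn-Banach below the norm, the ray of the pairs [(t v, - t |v|)] being the constraint
    [|v| <= f v]. *)
Lemma norming_functional (V : normedModType R) (v : V) :
  exists2 phi : dual V, `|phi| <= 1 & phi v = `|v|.
Proof.
pose S h a := exists2 t : R, 0 <= t & h = t *: v /\ a = - (t * `|v|).
have [|||f [lf fq fS]] := @hahn_banach V (fun u => `|u|) S.
- split=> [u w|c u c0]; first exact: ler_normD.
  by rewrite normrZ gtr0_norm.
- split.
  + by exists 0; rewrite // scale0r mul0r oppr0.
  + move=> _ _ _ _ [t t0 [-> ->]] [t' t'0 [-> ->]]; exists (t + t').
      by rewrite addr_ge0.
    by rewrite scalerDl mulrDl opprD.
  + move=> c _ _ c0 [t t0 [-> ->]]; exists (c * t).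
      by rewrite mulr_ge0// ltW.
    by rewrite scalerA mulrN mulrA.
- by move=> _ _ [t t0 [-> ->]]; rewrite normrZ ger0_norm// subrr.
have f_norm u : `|f u| <= 1 * `|u|.
  rewrite mul1r ler_norml fq andbT lerNl.
  pose fl : {linear V -> R^o} := HB.pack f (GRing.isLinear.Build _ _ _ _ _ lf).
  by rewrite -[f u]/(fl u) -linearN/= -normrN fq.
have fb : f \in @blin_pred R V (scalars R).
  by apply/asboolP; split=> //; exists 1.
exists (Blin fb).
  exact: blin_norm_le.
apply/eqP; rewrite eq_le fq/=.
rewrite -subr_ge0; apply: fS; exists 1 => //.
by rewrite scale1r mul1r.
Qed.

End hahn_banach.

(** * Finitely additive means on bounded functions *)

Section bounded_functions.
Context {R : realType} (W : Type).

Definition bfun_pred : {pred W -> R^o} := fun f => `[<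
  exists K : R, forall w, `|f w| <= K >].

Lemma bfun_submod_closed : submod_closed bfun_pred.
Proof.
split; first by apply/asboolP; exists 0 => w; rewrite normr0.
move=> c f g /asboolP[K HK] /asboolP[L HL]; apply/asboolP.
exists (`|c| * K + L) => w; rewrite !fctE (le_trans (ler_normD _ _))//.
by rewrite lerD// normrM ler_wpM2l.
Qed.

HB.instance Definition _ :=
  GRing.isSubmodClosed.Build R (W -> R^o) bfun_pred bfun_submod_closed.

Record bfun := BFun { bfun_fun :> W -> R^o; bfunP : bfun_fun \in bfun_pred }.

HB.instance Definition _ := [isSub for bfun_fun].
HB.instance Definition _ := [Choice of bfun by <:].
HB.instance Definition _ := [SubChoice_isSubLmodule of bfun by <:].

Lemma bfun_sumE n (f : 'I_n -> bfun) w : (\sum_(i < n) f i) w = \sum_(i < n) f i w.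
Proof. by elim/big_rec2: _ => //= i x y _ <-. Qed.

(** Hahn-Banach below the sublinear functional [sup f], which is finite because [w0] makes the
    domain nonempty. Being dominated by the supremum is what makes [M] positive and normalized. *)
Lemma bfun_mean (w0 : W) (S : bfun -> Prop) :
  S 0 -> (forall f g, S f -> S g -> S (f + g)) ->
  (forall c f, 0 < c -> S f -> S (c *: f)) ->
  (forall (f : bfun) (K : R), S f -> (forall w, f w <= K) -> 0 <= K) ->
  exists M : bfun -> R^o, [/\ linear M,
    forall (f : bfun) (K : R), (forall w, f w <= K) -> M f <= K
    & forall f, S f -> 0 <= M f].
Proof.
move=> S0 SD SZ Spos.
pose q (f : bfun) : R := sup (range f).
have q_has (f : bfun) : has_sup (range f).
  split; first by exists (f w0), w0.
  have /asboolP[K HK] := bfunP f.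
  by exists K => _ [w _ <-]; apply: le_trans (ler_norm _) (HK w).
have q_ub (f : bfun) w : f w <= q f.
  by apply: ub_le_sup; [case: (q_has f)|exists w].
have q_le (f : bfun) K : (forall w, f w <= K) -> q f <= K.
  by move=> HK; apply: ge_sup; [case: (q_has f)|move=> _ [w _ <-]].
have sq : sublinear q.
  split=> [f g|c f c0].
    by apply: q_le => w /=; rewrite lerD.
  by apply: q_le => w /=; rewrite ler_pM2l.
have [|f K [Sf ->]|M [lM Mq MS]] :=
    @hahn_banach R bfun q (fun f a => S f /\ a = 0) sq.
- split=> //.
  + by move=> f a g b [Sf ->] [Sg ->]; rewrite addr0; split=> //; exact: SD.
  + by move=> c f a c0 [Sf ->]; rewrite mulr0; split=> //; exact: SZ.
- by rewrite addr0; exact: Spos Sf (q_ub f).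
exists M; split=> //.
  by move=> f K HK; exact: le_trans (Mq f) (q_le _ _ HK).
by move=> f Sf; have := MS f 0 (conj Sf erefl); rewrite addr0.
Qed.

End bounded_functions.

(** * The abstract domination theorem *)

Section domination.
Context {R : realType}.

Lemma powR_invK (x p : R) : 0 <= x -> 0 < p -> (x `^ p^-1) `^ p = x.
Proof. by move=> x0 p0; rewrite -powRrM mulVf ?gt_eqF// powRr1. Qed.

Lemma powR_Kinv (x p : R) : 0 <= x -> 0 < p -> (x `^ p) `^ p^-1 = x.
Proof. by move=> x0 p0; rewrite -powRrM divff ?gt_eqF// powRr1. Qed.

Lemma powR_le1 (x q : R) : 0 <= q -> 0 <= x -> x <= 1 -> x `^ q <= 1.
Proof.
move=> q0 x0 x1; apply: le_trans (ge0_ler_powR q0 _ _ x1) _; rewrite ?nnegrE//.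
by rewrite powR1.
Qed.

(** Allows [x] and [y], which may vanish, to be replaced by strictly larger numbers by which one can
    divide. *)
Lemma ler_mul_gt (t C x y : R) : 0 < C -> 0 <= x -> 0 <= y ->
  (forall a b, x < a -> y < b -> t <= C * a * b) -> t <= C * x * y.
Proof.
move=> C0 x0 y0 h.
have h1 b : y < b -> t <= C * x * b.
  move=> yb; have b0 := le_lt_trans y0 yb.
  rewrite mulrAC -ler_pdivrMl ?mulr_gt0//; apply/ler_addgt0Pr => e e0.
  by rewrite ler_pdivrMl ?mulr_gt0// mulrAC h// ltrDl.
move: x0; rewrite le_eqVlt => /predU1P[x0|x0].
  by have := h1 (y + 1); rewrite ltrDl ltr01 -x0 mulr0 !mul0r; apply.
rewrite -ler_pdivrMl ?mulr_gt0//; apply/ler_addgt0Pr => e e0.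
by rewrite ler_pdivrMl ?mulr_gt0// h1// ltrDl.
Qed.

(** In the application [O1] and [O2] are the unit balls of X^# and E^**, [L] singles out the
    molecules and [t m e] is [m (e o T)]. The last two conclusions follow from linearity of the
    mean: the sum of the [N1 (m i) ^ r] is the mean of the sum of the [|a (m i)|^r], hence at most
    its upper bound. *)
Lemma domination (p r s C : R) (O1 O2 : Type) (V F : lmodType R)
    (L : V -> Prop) (a : V -> O1 -> R) (b : F -> O2 -> R) (t : V -> F -> R) :
  0 < p -> 0 < r -> 0 < s -> p^-1 = r^-1 + s^-1 -> 0 < C -> O1 -> O2 ->
  (forall c m, 0 < c -> L m -> L (c *: m)) ->
  (forall c m w, 0 < c -> a (c *: m) w = c * a m w) ->
  (forall c e w, 0 < c -> b (c *: e) w = c * b e w) ->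
  (forall c d m e, 0 < c -> 0 < d -> t (c *: m) (d *: e) = c * d * t m e) ->
  (forall m, exists K, forall w, `|a m w| <= K) ->
  (forall e, exists K, forall w, `|b e w| <= K) ->
  (forall n (m : 'I_n -> V) (e : 'I_n -> F) A B, (forall i, L (m i)) ->
    0 <= A -> 0 <= B ->
    (forall w, lq r%:E (fun i => a (m i) w) <= A) ->
    (forall w, lq s%:E (fun i => b (e i) w) <= B) ->
    lq p%:E (fun i => t (m i) (e i)) <= C * A * B) ->
  exists (N1 : V -> R) (N2 : F -> R),
    [/\ forall m, 0 <= N1 m, forall e, 0 <= N2 e,
      forall m e, L m -> `|t m e| <= C * N1 m * N2 e,
      forall n (m : 'I_n -> V) A, 0 <= A ->
        (forall w, lq r%:E (fun i => a (m i) w) <= A) ->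
        lq r%:E (fun i => N1 (m i)) <= A
    & forall n (e : 'I_n -> F) B, 0 <= B ->
        (forall w, lq s%:E (fun i => b (e i) w) <= B) ->
        lq s%:E (fun i => N2 (e i)) <= B].
Proof.
move=> p0 r0 s0 prs C0 o1 o2 LZ aZ bZ tZ abnd bbnd hyp.
pose W := (O1 * O2)%type.
have am_sub m : (fun w : W => `|a m w.1| `^ r) \in @bfun_pred R W.
  apply/asboolP; have [K HK] := abnd m; exists (K `^ r) => w.
  have K0 : 0 <= K := le_trans (normr_ge0 _) (HK w.1).
  rewrite ger0_norm ?powR_ge0//.
  by apply: ge0_ler_powR; rewrite ?nnegrE// ltW.
have bm_sub e : (fun w : W => `|b e w.2| `^ s) \in @bfun_pred R W.
  apply/asboolP; have [K HK] := bbnd e; exists (K `^ s) => w.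
  have K0 : 0 <= K := le_trans (normr_ge0 _) (HK w.2).
  rewrite ger0_norm ?powR_ge0//.
  by apply: ge0_ler_powR; rewrite ?nnegrE// ltW.
have one_sub : (fun _ : W => 1) \in @bfun_pred R W.
  by apply/asboolP; exists 1 => w; rewrite normr1.
pose am m : bfun W := BFun (am_sub m).
pose bm e : bfun W := BFun (bm_sub e).
pose one : bfun W := BFun one_sub.
pose z m e := `|t m e| `^ p / C `^ p.
pose h m e : bfun W := (p / r) *: am m + (p / s) *: bm e - z m e *: one.
have hE m e w : h m e w =
    p / r * `|a m w.1| `^ r + p / s * `|b e w.2| `^ s - z m e.
  by rewrite -[in RHS](mulr1 (z m e)).
pose S f := exists n (m : 'I_n -> V) (e : 'I_n -> F),
  (forall i, L (m i)) /\ f = \sum_(i < n) h (m i) (e i).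
have powZ (x c q : R) : 0 < c -> 0 < q -> `|c `^ q^-1 * x| `^ q = c * `|x| `^ q.
  move=> c0 q0; rewrite normrM powRM// ger0_norm ?powR_ge0// powR_invK// ltW//.
have [||||M [lM Mle MS]] := @bfun_mean R W (o1, o2) S.
- exists 0%N, (fun=> 0), (fun=> 0); split; first by case.
  by rewrite big_ord0.
- move=> _ _ [n [m [e [Lm ->]]]] [n' [m' [e' [Lm' ->]]]].
  exists (n + n')%N,
    (fun i => match fintype.split i with inl j => m j | inr j => m' j end),
    (fun i => match fintype.split i with inl j => e j | inr j => e' j end); split.
    by move=> i; case: (fintype.split i).
  rewrite big_split_ord/=; congr +%R; apply: eq_bigr => i _.
    by rewrite (unsplitK (inl i)).
  by rewrite (unsplitK (inr i)).
(* Scaling [m] by [c^(1/r)] and [e] by [c^(1/s)] scales [t] by [c^(1/p)], so each of the three terms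
   of [h] is multiplied by [c]. *)
- move=> c _ c0 [n [m [e [Lm ->]]]].
  exists n, (fun i => c `^ r^-1 *: m i), (fun i => c `^ s^-1 *: e i); split.
    by move=> i; apply: LZ => //; exact: powR_gt0.
  rewrite scaler_sumr; apply: eq_bigr => i _; apply/val_inj/funext => w.
  rewrite -[LHS]/(c * h _ _ w) -[RHS]/(h _ _ w) !hE.
  rewrite aZ ?powR_gt0// bZ ?powR_gt0// /z tZ ?powR_gt0//.
  rewrite -powRD ?(gt_eqF c0) ?implybT// -prs !powZ//=.
  by ring.
(* The two variables separate, so the bound [K] passes to the suprema: [p/r A + p/s B <= Z + K]. The
   summing inequality followed by Young gives [Z <= p/r A + p/s B], whence [0 <= K]. *)
- move=> _ K [n [m [e [Lm ->]]]] hK.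
  pose al w := \sum_(i < n) `|a (m i) w| `^ r.
  pose be w := \sum_(i < n) `|b (e i) w| `^ s.
  pose Z := \sum_(i < n) z (m i) (e i).
  have al0 w : 0 <= al w by apply: sumr_ge0 => i _; exact: powR_ge0.
  have be0 w : 0 <= be w by apply: sumr_ge0 => i _; exact: powR_ge0.
  have pr0 : 0 < p / r by rewrite divr_gt0.
  have ps0 : 0 < p / s by rewrite divr_gt0.
  have hZ w1 w2 : p / r * al w1 + p / s * be w2 <= Z + K.
    have := hK (w1, w2); rewrite bfun_sumE -lerBlDl.
    under eq_bigr do rewrite hE.
    apply: le_trans.
    by rewrite /al /be /Z !mulr_sumr -big_split -sumrB.
  pose A := sup (range al); pose B := sup (range be).
  have hA v : p / r * A <= Z + K - p / s * be v.
    rewrite -ler_pdivlMl//; apply: ge_sup; first by exists (al o1), o1.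
    by move=> _ [w1 _ <-]; rewrite ler_pdivlMl// lerBrDr.
  have hB : p / s * B <= Z + K - p / r * A.
    rewrite -ler_pdivlMl//; apply: ge_sup; first by exists (be o2), o2.
    by move=> _ [w2 _ <-]; rewrite ler_pdivlMl// lerBrDr -lerBrDl.
  have alA w : al w <= A.
    apply: ub_le_sup; last by exists w.
    exists ((p / r)^-1 * (Z + K - p / s * be o2)) => _ [w1 _ <-].
    by rewrite ler_pdivlMl// lerBrDr.
  have beB w : be w <= B.
    apply: ub_le_sup; last by exists w.
    exists ((p / s)^-1 * (Z + K - p / r * al o1)) => _ [w2 _ <-].
    by rewrite ler_pdivlMl// lerBrDl.
  have A0 : 0 <= A := le_trans (al0 o1) (alA o1).
  have B0 : 0 <= B := le_trans (be0 o2) (beB o2).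
  have hr w : lq r%:E (fun i => a (m i) w) <= A `^ r^-1.
    by rewrite lq_le ?powR_ge0// powR_invK//; exact: alA.
  have hs w : lq s%:E (fun i => b (e i) w) <= B `^ s^-1.
    by rewrite lq_le ?powR_ge0// powR_invK//; exact: beB.
  have := hyp n m e _ _ Lm (powR_ge0 A r^-1) (powR_ge0 B s^-1) hr hs.
  have AB0 : 0 <= A `^ r^-1 * B `^ s^-1 by rewrite mulr_ge0 ?powR_ge0.
  rewrite -mulrA lq_le ?(mulr_ge0 (ltW C0) AB0)// powRM ?(ltW C0)//.
  have := young_powR p0 r0 s0 prs (powR_ge0 A r^-1) (powR_ge0 B s^-1).
  rewrite !powR_invK// => Y.
  move=> T; have ZE : Z <= p / r * A + p / s * B.
    apply: le_trans Y; rewrite /Z /z -mulr_suml ler_pdivrMr ?powR_gt0//.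
    by rewrite mulrC.
  move: hB ZE; rewrite lerBrDl => hB ZE.
  by have := le_trans ZE hB; rewrite lerDl.
pose lMl : {linear bfun W -> R^o} := HB.pack M (GRing.isLinear.Build _ _ _ _ _ lM).
have M_ge0 (f : bfun W) : (forall w, 0 <= f w) -> 0 <= M f.
  move=> f0; rewrite -[M f]/(lMl f) -oppr_le0 -linearN; apply: Mle => w /=.
  by rewrite oppr_le0.
have sum_le q n (g : 'I_n -> bfun W) A : 0 < q -> 0 <= A ->
    (forall i w, 0 <= g i w) -> (forall w, \sum_(i < n) g i w <= A `^ q) ->
    lq q%:E (fun i => M (g i) `^ q^-1) <= A.
  move=> q0 A0 g0 gA; rewrite lq_le//.
  under eq_bigr => i _ do
    rewrite norm_powR ?M_ge0// ger0_norm ?M_ge0// powR_invK ?M_ge0//.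
  rewrite (_ : \sum_(i < n) _ = lMl (\sum_(i < n) g i)); last by rewrite linear_sum.
  by apply: Mle => w; rewrite bfun_sumE.
exists (fun m => M (am m) `^ r^-1), (fun e => M (bm e) `^ s^-1); split.
- by move=> m; exact: powR_ge0.
- by move=> e; exact: powR_ge0.
(* For [x > N1 m] and [y > N2 e], the rescaled [m / x] and [e / y] have means at most 1. As [M] is
   nonnegative on their [h] and [M one >= 1], this forces [z <= p/r + p/s = 1], that is,
   [|t m e| <= C x y]. *)
- move=> m e Lm; apply: ler_mul_gt; rewrite ?powR_ge0// => x y.
  have am0 : 0 <= M (am m) by apply: M_ge0 => w; exact: powR_ge0.
  have bm0 : 0 <= M (bm e) by apply: M_ge0 => w; exact: powR_ge0.
  move=> mx ey; have x0 := le_lt_trans (powR_ge0 _ _) mx.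
  have y0 := le_lt_trans (powR_ge0 _ _) ey.
  have /MS : S (h (x^-1 *: m) (y^-1 *: e)).
    exists 1%N, (fun=> x^-1 *: m), (fun=> y^-1 *: e); split.
      by move=> _; apply: LZ; rewrite ?invr_gt0.
    by rewrite big_ord1.
  have -> : M (h (x^-1 *: m) (y^-1 *: e)) = p / r * M (am (x^-1 *: m)) +
      p / s * M (bm (y^-1 *: e)) - z (x^-1 *: m) (y^-1 *: e) * M one.
    by rewrite -[LHS]/(lMl _) linearB linearD !linearZ.
  move=> hM.
  have one1 : 1 <= M one.
    rewrite -[M one]opprK lerNr -[M one]/(lMl one) -linearN; apply: Mle => w.
    by [].
  have amE : am (x^-1 *: m) = (x^-1 `^ r) *: am m.
    apply/val_inj/funext => w /=; rewrite aZ ?invr_gt0// normrM powRM//.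
    by rewrite gtr0_norm ?invr_gt0.
  have bmE : bm (y^-1 *: e) = (y^-1 `^ s) *: bm e.
    apply/val_inj/funext => w /=; rewrite bZ ?invr_gt0// normrM powRM//.
    by rewrite gtr0_norm ?invr_gt0.
  have am1 : M (am (x^-1 *: m)) <= 1.
    rewrite amE -[M _]/(lMl _) linearZ /= /GRing.scale /=.
    rewrite -[X in _ * X](powR_invK am0 r0) -powRM ?invr_ge0 ?(ltW x0) ?powR_ge0//.
    apply: powR_le1; first exact: ltW.
      by rewrite mulr_ge0 ?powR_ge0// invr_ge0 ltW.
    by rewrite ler_pdivrMl// mulr1 ltW.
  have bm1 : M (bm (y^-1 *: e)) <= 1.
    rewrite bmE -[M _]/(lMl _) linearZ /= /GRing.scale /=.
    rewrite -[X in _ * X](powR_invK bm0 s0) -powRM ?invr_ge0 ?(ltW y0) ?powR_ge0//.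
    apply: powR_le1; first exact: ltW.
      by rewrite mulr_ge0 ?powR_ge0// invr_ge0 ltW.
    by rewrite ler_pdivrMl// mulr1 ltW.
  have z1 : z (x^-1 *: m) (y^-1 *: e) <= 1.
    have z0 : 0 <= z (x^-1 *: m) (y^-1 *: e) by rewrite divr_ge0 ?powR_ge0.
    have : z (x^-1 *: m) (y^-1 *: e) * M one <=
        p / r * M (am (x^-1 *: m)) + p / s * M (bm (y^-1 *: e)).
      by rewrite -subr_ge0.
    move=> zle; apply: le_trans (ler_peMr z0 one1) (le_trans zle _).
    apply: (@le_trans _ _ (p / r * 1 + p / s * 1)).
      by rewrite lerD// ler_wpM2l// divr_ge0// ltW.
    by rewrite !mulr1 -mulrDr -prs divff ?gt_eqF.
  move: z1; rewrite /z ler_pdivrMr ?powR_gt0// mul1r.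
  move=> /(fun H => ge0_ler_powR (ltW _) _ _ H).
  rewrite tZ ?invr_gt0// => /(_ p^-1); rewrite invr_gt0 !nnegrE !powR_ge0.
  move=> /(_ p0 isT isT); rewrite !powR_Kinv// ?(ltW C0)//.
  rewrite normrM gtr0_norm ?mulr_gt0 ?invr_gt0// -invfM ler_pdivrMl ?mulr_gt0//.
  by rewrite mulrAC mulrC mulrA [y * x]mulrC mulrC mulrA.
- move=> n m A A0 mA; apply: sum_le => // [i w|w]; first exact: powR_ge0.
  by have := mA w.1; rewrite lq_le.
- move=> n e B B0 eB; apply: sum_le => // [i w|w]; first exact: powR_ge0.
  by have := eB w.2; rewrite lq_le.
Qed.

End domination.

(** * The Banach space G of vectors dominated by a weight on the dual *)

Section weighted_subspace.
Context {R : realType}.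

(** The upper bound makes the inclusion of the weighted subspace into [E] a contraction, on which
    its completeness rests. *)
Record weight (E : normedModType R) := Weight {
  weight_fun :> dual E -> R;
  weightP : forall e, 0 <= weight_fun e <= `|e| }.

Context {E : completeNormedModType R} (w : weight E).

Lemma weight_ge0 e : 0 <= w e. Proof. by have /andP[] := weightP w e. Qed.

Definition wsub_pred : {pred E} := fun v => `[<
  exists K : R, forall e : dual E, `|e v| <= K * w e >].

Lemma wsub_submod_closed : submod_closed wsub_pred.
Proof.
split.
  by apply/asboolP; exists 0 => e; rewrite linear0 normr0 mul0r.
move=> c u v /asboolP[K HK] /asboolP[L HL]; apply/asboolP.
exists (`|c| * K + L) => e; rewrite linearP (le_trans (ler_normD _ _))//.
rewrite mulrDl; apply: lerD; last exact: HL.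
apply: (@le_trans _ _ (`|c| * `|e u|)).
  by rewrite -normrM.
by rewrite -mulrA ler_wpM2l.
Qed.

HB.instance Definition _ :=
  GRing.isSubmodClosed.Build R E wsub_pred wsub_submod_closed.

Record wsub := WSub { wsub_val :> E; wsubP : wsub_val \in wsub_pred }.

HB.instance Definition _ := [isSub for wsub_val].
HB.instance Definition _ := [Choice of wsub by <:].
HB.instance Definition _ := [SubChoice_isSubLmodule of wsub by <:].

HB.instance Definition _ := GRing.isLinear.Build R wsub E *:%R wsub_val
  (fun k u v => erefl).

(** This is the supremum of [|e v| / w e], in a form that allows [w e = 0]; membership in [wsub]
    forces [e v = 0] there. *)
Definition wsub_norm : wsub -> R :=
  best_const (fun (e : dual E) (v : wsub) => `|e (wsub_val v)|) w.

Let bnd (v : wsub) : exists K : R, forall e : dual E, `|e (wsub_val v)| <= K * w e.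
Proof. exact/asboolP/(wsubP v). Qed.

Let aD (e : dual E) (u v : wsub) :
  `|e (wsub_val (u + v))| <= `|e (wsub_val u)| + `|e (wsub_val v)|.
Proof. by rewrite !linearD ler_normD. Qed.

Let aZ (e : dual E) c (v : wsub) :
  `|e (wsub_val (c *: v))| = `|c| * `|e (wsub_val v)|.
Proof. by rewrite -[wsub_val (c *: v)]/(c *: wsub_val v) linearZ; exact: normrM. Qed.

Let wsub_normD u v : wsub_norm (u + v) <= wsub_norm u + wsub_norm v.
Proof. exact: best_constD weight_ge0 aD bnd u v. Qed.

Let wsub_normZ c v : wsub_norm (c *: v) = `|c| * wsub_norm v.
Proof. exact: best_constZ weight_ge0 aZ bnd c v. Qed.

Let wsub_norm0_eq0 v : wsub_norm v = 0 -> v = 0.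
Proof.
move=> v0; apply/val_inj/normr0_eq0 => /=.
have [phi _ <-] := norming_functional (wsub_val v).
apply: normr0_eq0.
exact: (best_const0P (a := fun (e : dual E) (v : wsub) => `|e (wsub_val v)|)
  weight_ge0 (fun _ _ => normr_ge0 _) bnd v0 phi).
Qed.

HB.instance Definition _ :=
  Lmodule_isNormed.Build R wsub wsub_normD wsub_normZ wsub_norm0_eq0.

Lemma wsub_normP (v : wsub) (e : dual E) : `|e (wsub_val v)| <= `|v| * w e.
Proof.
exact: (best_constP (a := fun (e : dual E) (v : wsub) => `|e (wsub_val v)|)
  weight_ge0 bnd v e).
Qed.

Lemma wsub_norm_le (v : wsub) (K : R) : 0 <= K ->
  (forall e : dual E, `|e (wsub_val v)| <= K * w e) -> `|v| <= K.
Proof.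
exact: (best_const_le (a := fun (e : dual E) (v : wsub) => `|e (wsub_val v)|)
  weight_ge0 bnd).
Qed.

(** A norming functional of [v] has norm at most 1, hence weight at most 1. *)
Lemma wsub_val_norm (v : wsub) : `|wsub_val v| <= `|v|.
Proof.
have [phi phi1 phiE] := norming_functional (wsub_val v).
rewrite -phiE (le_trans (ler_norm _))// (le_trans (wsub_normP _ _))//.
rewrite -[leRHS]mulr1 ler_wpM2l// (le_trans _ phi1)//.
by have /andP[] := weightP w phi.
Qed.

(** The filter converges in [E] to some [l]. The estimates that define the norm hold for each [e]
    separately and survive the limit in [E], so [l] lies in the subspace and is the limit there
    too. *)
Lemma wsub_complete (F : set_system wsub) : ProperFilter F -> cauchy F -> cvg F.
Proof.
move=> FF /cauchyP Fc.
have Fval : cauchy (wsub_val @ F).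
  apply/cauchyP => e /Fc[x Fx]; exists (wsub_val x).
  change (F (wsub_val @^-1` ball (wsub_val x) e)); apply: filterS Fx => y.
  rewrite -!ball_normE /=.
  exact: le_lt_trans (wsub_val_norm (x - y)).
pose l : E := lim (wsub_val @ F).
have Fl : wsub_val @ F --> l by exact: cauchy_cvg.
have close (eps : R) : 0 < eps -> exists2 x : wsub, F (ball x eps) &
    forall e : dual E, `|e (wsub_val x - l)| <= eps * w e.
  move=> eps0; have [x Fx] := Fc _ eps0; exists x => // e.
  apply/ler_addgt0Pr => d d0; have e1 : 0 < `|e| + 1 by rewrite ltr_wpDl.
  (* The tolerance makes [|e (y - l)|] at most [d]; adding 1 keeps the denominator positive. *)
  have [y [xy yl]] : exists y, ball x eps y /\ `|l - wsub_val y| < d / (`|e| + 1).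
    have /cvgrPdist_lt/(_ (d / (`|e| + 1))) : wsub_val @ F --> l by [].
    by rewrite divr_gt0// => /(_ isT)/(filterI Fx)/filter_ex.
  rewrite -[wsub_val x](subrK (wsub_val y)) -addrA linearD.
  rewrite (le_trans (ler_normD _ _))// lerD//.
    rewrite -linearB (le_trans (wsub_normP _ _))// ler_wpM2r ?weight_ge0//.
    by move: xy; rewrite -ball_normE /= => /ltW.
  rewrite (le_trans (blin_normP _ _))// distrC.
  rewrite (le_trans (ler_wpM2l _ (ltW yl)))// mulrCA ger_pMr//.
  by rewrite ler_pdivrMr// mul1r lerDl.
have lw : l \in wsub_pred.
  have [x _ xl] := close 1 ltr01; apply/asboolP; exists (`|x| + 1) => e.
  rewrite -[l](subKr (wsub_val x)) linearB (le_trans (ler_normB _ _))//.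
  rewrite mulrDl; apply: lerD; first exact: wsub_normP.
  exact: xl.
apply/cvg_ex; exists (WSub lw); apply/cvgrPdist_le => eps eps0.
have [|x Fx xl] := close (eps / 2); first by rewrite divr_gt0.
apply: filterS Fx => y; rewrite -ball_normE /= => xy.
rewrite -[WSub lw - y](subrKA x) (le_trans (ler_normD _ _))// [leRHS]splitr.
rewrite lerD ?(ltW xy)// distrC; apply: wsub_norm_le => //.
by rewrite divr_ge0// ltW.
Qed.

HB.instance Definition _ := Uniform_isComplete.Build wsub wsub_complete.

Definition wspace : completeNormedModType R :=
  CompleteNormedModule.clone R wsub _.

End weighted_subspace.

(** * Weak norms, molecules and the dual of the free space *)

Section lipschitz_tools.
Context {R : realType}.

Lemma blin_sumE (V W : normedModType R) n (f : 'I_n -> blin V W) v :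
  (\sum_(i < n) f i) v = \sum_(i < n) f i v.
Proof. by elim/big_rec2: _ => //= i x y _ <-. Qed.

(** The real [sup] is an upper bound only of a set that is bounded above; the constants [K i]
    provide the bound. *)
Lemma lq_ball_ub (V : normedModType R) (r : R) n (m : 'I_n -> V -> R)
    (K : 'I_n -> R) : 0 < r -> (forall i f, `|m i f| <= K i * `|f|) ->
  forall f, `|f| <= 1 -> lq r%:E (fun i => m i f) <=
    sup [set lq r%:E (fun i => m i f) | f in [set f : V | `|f| <= 1]].
Proof.
move=> r0 mK f f1; apply: ub_le_sup; last by exists f.
exists (lq r%:E K) => _ [g /= g1 <-]; apply: lq_mono => // i.
apply: le_trans (mK i g) _; have [K0|K0] := leP 0 (K i).
  by rewrite [leRHS]ger0_norm// -[leRHS]mulr1 ler_wpM2l.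
by rewrite (@le_trans _ _ 0)// mulr_le0_ge0// ltW.
Qed.

Lemma weak_lq_ub (V : normedModType R) (r : R) n (v : 'I_n -> V) (phi : dual V) :
  0 < r -> `|phi| <= 1 -> lq r%:E (fun i => phi (v i)) <= weak_lq r%:E v.
Proof.
move=> r0; apply: (@lq_ball_ub (dual V) r n (fun i phi => phi (v i))
  (fun i => `|v i|)) => //.
by move=> i f; rewrite mulrC blin_normP.
Qed.

Lemma weak_lq_le (V : normedModType R) q n (v : 'I_n -> V) (K : R) :
  (forall phi : dual V, `|phi| <= 1 -> lq q (fun i => phi (v i)) <= K) ->
  weak_lq q v <= K.
Proof.
move=> h; apply: ge_sup; last by move=> _ [phi phi1 <-]; exact: h.
by exists (lq q (fun i => (0 : dual V) (v i))), 0 => //=; rewrite normr0.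
Qed.

Lemma weak_lq_ge0 (V : normedModType R) (r : R) n (v : 'I_n -> V) : 0 < r ->
  0 <= weak_lq r%:E v.
Proof.
move=> r0; apply: le_trans (weak_lq_ub v (phi := 0) r0 _); first exact: lq_ge0.
by rewrite normr0.
Qed.

Lemma lq_const1 (r x : R) : 0 < r -> lq r%:E (fun _ : 'I_1 => x) = `|x|.
Proof. by move=> r0; rewrite /= big_ord1 powR_Kinv. Qed.

Lemma lq_mono_ereal (q : \bar R) n (a b : 'I_n -> R) : (0 < q)%E ->
  (forall i, `|a i| <= `|b i|) -> lq q a <= lq q b.
Proof.
case: q => [q|_ ab|//]; first by rewrite lte_fin => q0; apply: (@lq_mono R).
rewrite /=; elim/big_ind2: _ => // [x1 x2 y1 y2 x12 y12].
by rewrite ge_max !le_max x12 y12 orbT.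
Qed.

Context {X : metricType R} {x0 : X}.

Section lip_comp.
Context {E : normedModType R} (T : lip0 x0 E).

Lemma lip_comp_subproof (e : dual E) :
  (fun x => e (T x)) \in @lip0_pred R X x0 (scalars R).
Proof.
apply/asboolP; split.
  by have /asboolP[-> _] := lip0P T; rewrite linear0.
exists (`|e| * `|T|) => x y; rewrite -linearB.
by rewrite (le_trans (blin_normP _ _))// -mulrA ler_wpM2l// lip0_normP.
Qed.

Definition lip_comp (e : dual E) : lipdual x0 := Lip0 (lip_comp_subproof e).

Lemma lip_compP : linear lip_comp.
Proof. by move=> c e e'; apply/val_inj. Qed.

End lip_comp.

(** The span is not closed: the (p,r,s)-inequality speaks of finite combinations of deltas, and
    limits are treated separately by approximation. *)
Definition molecule : set (dual (lipdual x0)) :=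
  lspan [set m | exists x y, m = delta x0 x y].

Lemma molecule_delta x y : molecule (delta x0 x y).
Proof.
exists 1%N, (fun=> 1), (fun=> delta x0 x y); split; first by move=> _; exists x, y.
by rewrite big_ord1 scale1r.
Qed.

Lemma moleculeZ c m : molecule m -> molecule (c *: m).
Proof.
move=> [n [k [u [uD ->]]]]; exists n, (fun i => c * k i), u; split=> //.
by rewrite scaler_sumr; apply: eq_bigr => i _; rewrite scalerA.
Qed.

Lemma molecule_seq m : molecule m -> exists s : seq (R * (X * X)),
  forall f : lipdual x0, m f = \sum_(a <- s) a.1 * (f a.2.1 - f a.2.2).
Proof.
move=> [n [k [u [uD ->]]]].
have /choice[xy xyP] : forall i, exists xy : X * X, u i = delta x0 xy.1 xy.2.
  by move=> i; have [x [y ->]] := uD i; exists (x, y).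
exists [seq (k i, xy i) | i <- enum 'I_n] => f.
rewrite blin_sumE big_map big_enum /=; apply: eq_bigr => i _.
by rewrite xyP.
Qed.

(** The (p,r,s)-inequality uses one inner length for all [i], so shorter combinations are padded
    with terms of coefficient 0. *)
Lemma molecules_uniform n (m : 'I_n -> dual (lipdual x0)) :
  (forall i, molecule (m i)) ->
  exists n' (k : 'I_n -> 'I_n' -> R) (x y : 'I_n -> 'I_n' -> X), (0 < n')%N /\
  forall i (f : lipdual x0), m i f = \sum_(j < n') k i j * (f (x i j) - f (y i j)).
Proof.
move=> mD.
have /choice[s sP] : forall i, exists s : seq (R * (X * X)),
    forall f : lipdual x0, m i f = \sum_(a <- s) a.1 * (f a.2.1 - f a.2.2).
  by move=> i; exact: molecule_seq.
(* The successor keeps the common length positive even if all combinations are empty. *)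
pose N := (\max_(i < n) size (s i)).+1.
pose d : R * (X * X) := (0, (x0, x0)).
exists N, (fun i j => (nth d (s i) j).1), (fun i j => (nth d (s i) j).2.1),
  (fun i j => (nth d (s i) j).2.2); split=> // i f.
have sN : (size (s i) <= N)%N by rewrite ltnW// ltnS; exact: (leq_bigmax i).
rewrite sP (big_nth d) -(big_mkord xpredT
  (fun j => (nth d (s i) j).1 * (f (nth d (s i) j).2.1 - f (nth d (s i) j).2.2))).
rewrite [RHS](@big_cat_nat _ _ _ (size (s i)))//=.
rewrite [X in _ = _ + X]big1_seq ?addr0// => j.
rewrite mem_index_iota => /andP[_ /andP[sj _]].
by rewrite nth_default//= mul0r.
Qed.

Lemma lspan_approx (V : normedModType R) (A : set V) (m : cspan A) (eps : R) :
  0 < eps -> exists2 m', lspan A m' & `|cspan_val m - m'| < eps.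
Proof.
move=> e0; have /asboolP cm := cspanP m.
have [m' [Lm']] := cm _ (nbhsx_ballx (cspan_val m) eps e0).
by rewrite -ball_normE /= => ?; exists m'.
Qed.

Lemma delta_norm x y : `|delta x0 x y| <= mdist x y.
Proof.
apply: blin_norm_le => [|f]; first exact: mdist_ge0.
by rewrite mulrC; exact: lip0_normP.
Qed.

(** One half of F(X)^* = X^#: evaluation at [f] is a functional of norm at most [|f|]. The converse
    is [free_dual_lip]. *)
Definition free_eval_fun (f : lipdual x0) : free_space x0 -> R^o :=
  fun m => cspan_val m f.

Lemma free_eval_subproof f :
  free_eval_fun f \in @blin_pred R (free_space x0) (scalars R).
Proof.
apply/asboolP; split=> [c m m'|].
  by rewrite /free_eval_fun linearP.
by exists `|f| => m; rewrite mulrC; exact: blin_normP.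
Qed.

Definition free_eval f : dual (free_space x0) := Blin (free_eval_subproof f).

Lemma free_eval_norm f : `|free_eval f| <= `|f|.
Proof.
apply: blin_norm_le => // m; rewrite mulrC.
exact: (blin_normP (cspan_val m) f).
Qed.

(** Put [f x = Phi (delta (x, x0))]. Differences of such deltas are again deltas, and the norm of
    [delta (x, y)] is at most the distance. *)
Lemma free_dual_lip (Phi : dual (free_space x0)) :
  exists2 f : lipdual x0, `|f| <= `|Phi| &
    forall x y, Phi (free_delta x0 x y) = f x - f y.
Proof.
pose g x := Phi (free_delta x0 x x0).
have gE x y : Phi (free_delta x0 x y) = g x - g y.
  rewrite -linearB; congr (Phi _); apply/val_inj/val_inj/funext => f /=.
  rewrite /delta_fun.
  by rewrite opprB addrA subrK.
have g_lip x y : `|g x - g y| <= `|Phi| * mdist x y.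
  by rewrite -gE (le_trans (blin_normP _ _))// ler_wpM2l// delta_norm.
have gP : g \in @lip0_pred R X x0 (scalars R).
  apply/asboolP; split; last by exists `|Phi|.
  by rewrite /g gE subrr.
by exists (Lip0 gP) => //; exact: lip0_norm_le.
Qed.

End lipschitz_tools.

(** * Domination for strictly Lipschitz (p,r,s)-summing operators *)

Section factorization.
Context {R : realType} {X : metricType R} {x0 : X}.

Lemma summing_domination (E : normedModType R) (T : lip0 x0 E) (p r s : R) :
  0 < p -> 0 < r -> 0 < s -> p^-1 = r^-1 + s^-1 ->
  strictly_lipschitz_prs_summing p r s T ->
  exists (C : R) (N1 : dual (lipdual x0) -> R) (N2 : dual E -> R),
    [/\ 0 < C, (forall m, 0 <= N1 m) /\ forall e, 0 <= N2 e,
      forall m e, molecule m -> `|m (lip_comp T e)| <= C * N1 m * N2 e,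
      forall n (m : 'I_n -> dual (lipdual x0)) (A : R), 0 <= A ->
        (forall f : lipdual x0, `|f| <= 1 -> lq r%:E (fun i => m i f) <= A) ->
        lq r%:E (fun i => N1 (m i)) <= A
    & forall n (e : 'I_n -> dual E),
        lq s%:E (fun i => N2 (e i)) <= weak_lq s%:E e].
Proof.
move=> p0 r0 s0 prs [C C0 H].
pose O1 := {f : lipdual x0 | `|f| <= 1}.
pose O2 := {phi : dual (dual E) | `|phi| <= 1}.
have o1 : O1 by exists 0; rewrite normr0.
have o2 : O2 by exists 0; rewrite normr0.
have [|||||||N1 [N2 [N10 N20 N12 N1s N2s]]] := @domination R p r s C O1 O2
    (dual (lipdual x0)) (dual E) molecule (fun m f => m (sval f))
    (fun e phi => sval phi e) (fun m e => m (lip_comp T e)) p0 r0 s0 prs C0 o1 o2.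
- by move=> c m _; exact: moleculeZ.
- by [].
- by move=> c e phi _; rewrite linearZ.
- move=> c d m e _ _.
  have -> : lip_comp T (d *: e) = d *: lip_comp T e by apply/val_inj.
  change (c * m (d *: lip_comp T e) = c * d * m (lip_comp T e)).
  by rewrite linearZ; exact: mulrA.
- move=> m; exists `|m| => -[f f1] /=; rewrite (le_trans (blin_normP _ _))//.
  by rewrite -[leRHS]mulr1 ler_wpM2l.
- move=> e; exists `|e| => -[f f1] /=; rewrite (le_trans (blin_normP _ _))//.
  by rewrite mulrC -[leRHS]mulr1 ler_wpM2l.
- move=> n m e A B mD A0 B0 mA eB.
  (* The summing inequality is stated for nonempty families; the empty one is trivial. *)
  have [n0|n0] := posnP n.
    have CAB : 0 <= C * A * B by rewrite !mulr_ge0// ltW.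
    by subst n; rewrite lq_le// big_ord0 powR_ge0.
  have [n' [k [x [y [n'0 mE]]]]] := molecules_uniform mD.
  have := H n n' n0 n'0 x y k e; set a := sup _ => h.
  pose g (f : lipdual x0) :=
    lq r%:E (fun i => \sum_(j < n') k i j * (f (x i j) - f (y i j))).
  have gA (f : lipdual x0) : `|f| <= 1 -> g f <= A.
    move=> f1; have := mA (exist _ f f1) => /=.
    by under eq_fun do rewrite mE.
  have zero1 : `|0 : lipdual x0| <= 1 by rewrite normr0.
  have aA : a <= A.
    apply: ge_sup; first by exists (g 0), 0.
    by move=> _ [f /= f1 <-]; exact: gA.
  have a0 : 0 <= a.
    apply: (@le_trans _ _ (g 0)); first exact: lq_ge0.
    apply: ub_le_sup; last by exists 0.
    by exists A => _ [f /= f1 <-]; exact: gA.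
  have eB' : weak_lq s%:E e <= B.
    by apply: weak_lq_le => phi phi1; exact: (eB (exist _ phi phi1)).
  have -> : (fun i => m i (lip_comp T (e i))) =
      (fun i => e i (\sum_(j < n') k i j *: (T (x i j) - T (y i j)))).
    apply/funext => i; rewrite mE linear_sum; apply: eq_bigr => j _.
    by rewrite linearZ linearB.
  apply: le_trans h _; apply: le_trans (ler_wpM2l _ eB') _; last first.
    by rewrite ler_wpM2r// ler_wpM2l// ltW.
  by rewrite mulr_ge0// ltW.
exists C, N1, N2; split=> //.
- by move=> n m A A0 mA; apply: N1s => // -[f f1]; exact: mA.
- move=> n e; apply: N2s; first exact: weak_lq_ge0.
  by move=> [phi phi1]; exact: weak_lq_ub.
Qed.

End factorization.

(** * From domination to strict Lipschitz r-summability *)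

Section strictly_summing.
Context {R : realType} {X : metricType R} {x0 : X} {G : normedModType R}.
Variable U : lip0 x0 G.

(* Since g o U lies in X^#, elements of F(X) apply to it directly, so U need not
   be extended to F(X). *)
Definition lip_form_fun (m : free_space x0) (g : dual G) : R^o :=
  cspan_val m (lip_comp U g).

Lemma lip_form_bilinear : bilinear_for *:%R *:%R lip_form_fun.
Proof.
split=> [g c m m'|m c g g']; rewrite /lip_form_fun; first by rewrite linearP.
by rewrite lip_compP linearP.
Qed.

HB.instance Definition _ := bilinear_isBilinear.Build R _ _ _ _ _
  lip_form_fun lip_form_bilinear.

(** The value on [u] can be computed from any representation by [m_i] and [h_i]. Approximating each
    [m_i] by a molecule brings in the domination, Hoelder bounds the sum, and the approximation
    error tends to 0. *)
Lemma strictly_summing_of_domination (r C : R) (N : dual (lipdual x0) -> R) :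
  1 <= r -> 0 < C -> (forall m, 0 <= N m) ->
  (forall m g, molecule m -> `|m (lip_comp U g)| <= C * N m * `|g|) ->
  (forall n (m : 'I_n -> dual (lipdual x0)) (A : R), 0 <= A ->
    (forall f : lipdual x0, `|f| <= 1 -> lq r%:E (fun i => m i f) <= A) ->
    lq r%:E (fun i => N (m i)) <= A) ->
  strictly_lipschitz_summing r%:E U.
Proof.
move=> r1 C0 N0 UN Nr; have r0 : 0 < r by rewrite (lt_le_trans ltr01).
exists C => // l x y gs; rewrite mulrC -ler_pdivrMr//; apply: lb_le_inf.
  (* The infimum is over a nonempty set: [u] represents itself. *)
  exists (weak_lq r%:E (fun k => free_delta x0 (x k) (y k)) *
    strong_lq (hoelder_conjugate r%:E) gs).
  exists l, x, y, gs; split=> //.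
  by exists l, (fun k => free_delta x0 (x k) (y k)), gs.
move=> _ [l' [x' [y' [gs' [/lip_tens_free_tens eqT [n [m [hs [eqm ->]]]]]]]]].
set W := weak_lq _ m; set L := strong_lq _ hs.
rewrite ler_pdivrMr// mulrC.
(* The tensor identity is evaluated at the bilinear form [lip_form_fun]. *)
have -> : \sum_(k < l) gs k (U (x k) - U (y k)) =
    \sum_(i < n) cspan_val (m i) (lip_comp U (hs i)).
  pose form := {bilinear free_space x0 -> dual G -> R^o}.
  have := congr1 (fun F => F (lip_form_fun : form)) (eqT : _ = _ :> (form -> R^o)).
  rewrite -eqm !fct_sumE => E; rewrite -[RHS]E; apply: eq_bigr => k _.
  by rewrite linearB.
pose D := \sum_(i < n) `|lip_comp U (hs i)|.
pose K := lq r%:E (fun _ : 'I_n => 1 : R).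
have L0 : 0 <= L := lq_ge0 _ _.
have D0 : 0 <= D by apply: sumr_ge0.
have K0 : 0 <= K := lq_ge0 _ _.
have W0 : 0 <= W := weak_lq_ge0 m r0.
have bound (e : R) : 0 < e ->
    `|\sum_(i < n) cspan_val (m i) (lip_comp U (hs i))| <=
    e * D + C * ((W + e * K) * L).
  move=> e0.
  have /choice[m' m'P] : forall i, exists m' : dual (lipdual x0),
      molecule m' /\ `|cspan_val (m i) - m'| < e.
    by move=> i; have [m' ? ?] := lspan_approx (m i) e0; exists m'.
  have mm' i (f : lipdual x0) : `|cspan_val (m i) f - m' i f| <= e * `|f|.
    apply: le_trans (blin_normP (cspan_val (m i) - m' i) f) _.
    by rewrite ler_wpM2r// ltW//; case: (m'P i).
  have NW : lq r%:E (fun i => N (m' i)) <= W + e * K.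
    apply: Nr => [|f f1]; first by rewrite addr_ge0 ?mulr_ge0// ltW.
    have -> : (fun i => m' i f) =
        (fun i => cspan_val (m i) f + (m' i f - cspan_val (m i) f)).
      by apply/funext => i; rewrite addrC subrK.
    apply: le_trans (lqD _ _ r1) _; apply: lerD.
      apply: (weak_lq_ub m (phi := free_eval f)) => //.
      exact: le_trans (free_eval_norm f) f1.
    apply: lq_const_le; rewrite ?(ltW e0)// => i; rewrite distrC.
    by apply: le_trans (mm' i f) _; rewrite -[leRHS]mulr1 ler_wpM2l// ltW.
  have -> : \sum_(i < n) cspan_val (m i) (lip_comp U (hs i)) =
      \sum_(i < n) (cspan_val (m i) (lip_comp U (hs i)) - m' i (lip_comp U (hs i)))
      + \sum_(i < n) m' i (lip_comp U (hs i)).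
    by rewrite -big_split; apply: eq_bigr => i _; rewrite /= subrK.
  apply: le_trans (ler_normD _ _) _; apply: lerD.
    apply: le_trans (ler_norm_sum _ _ _) _; rewrite /D mulr_sumr.
    by apply: ler_sum => i _; exact: mm'.
  apply: le_trans (ler_norm_sum _ _ _) _.
  apply: (@le_trans _ _ (\sum_(i < n) C * (`|N (m' i)| * `| `|hs i| |))).
    apply: ler_sum => i _; rewrite normr_id (ger0_norm (N0 _)) mulrA.
    by apply: UN; case: (m'P i).
  rewrite -mulr_sumr ler_wpM2l ?(ltW C0)//.
  apply: le_trans (lq_hoelder_conjugate (fun i => N (m' i)) (fun i => `|hs i|) r1) _.
  by rewrite ler_wpM2r.
apply/ler_addgt0Pr => d d0.
have D'0 : 0 < D + C * K * L + 1 by rewrite ltr_wpDl// addr_ge0// !mulr_ge0// ltW.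
(* With this tolerance the total error [e (D + C K L)] is at most [d]. *)
have e0 : 0 < d / (D + C * K * L + 1) by rewrite divr_gt0.
apply: le_trans (bound _ e0) _.
set e := d / _ in e0 *.
have -> : e * D + C * ((W + e * K) * L) = C * (W * L) + e * (D + C * K * L) by ring.
rewrite lerD2l /e mulrAC ler_pdivrMr// ler_wpM2l ?(ltW d0)//.
by rewrite lerDl.
Qed.

End strictly_summing.

(** * Summing operators factor: (1) implies (2) *)

Section factorization.
Context {R : realType} {X : metricType R} {x0 : X}.

Lemma prs_summing_factors (E : completeNormedModType R) (T : lip0 x0 E)
    (p r s : R) : 0 < p -> 1 <= r -> 1 <= s -> p^-1 = r^-1 + s^-1 ->
  strictly_lipschitz_prs_summing p r s T ->
  exists (G : completeNormedModType R) (U : lip0 x0 G) (S : blin G E),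
    [/\ strictly_lipschitz_summing r%:E U,
        cohen_strongly_summing (hoelder_conjugate s%:E) S
      & T = S \o U :> (X -> E)].
Proof.
move=> p0 r1 s1 prs Ts.
have r0 : 0 < r by rewrite (lt_le_trans ltr01).
have s0 : 0 < s by rewrite (lt_le_trans ltr01).
have [C [N1 [N2 [C0 [N10 N20] N12 N1r N2s]]]] := summing_domination p0 r0 s0 prs Ts.
(* One-term families give [N2 e <= |e|], so [N2] is a weight; in the same way [N1] of a delta is at
   most the distance, which makes [U] Lipschitz. *)
have N2_norm e : 0 <= N2 e <= `|e|.
  rewrite N20/= -[N2 e](ger0_norm (N20 e)) -(lq_const1 _ s0).
  apply: le_trans (N2s 1%N (fun=> e)) _; apply: weak_lq_le => phi phi1.
  rewrite lq_const1//; apply: le_trans (blin_normP _ _) _.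
  by rewrite -[leRHS]mul1r ler_wpM2r.
have N1_delta x y : N1 (delta x0 x y) <= mdist x y.
  rewrite -[N1 _](ger0_norm (N10 _)) -(lq_const1 _ r0).
  apply: (N1r 1%N (fun=> delta x0 x y)) => [|f f1]; first exact: mdist_ge0.
  rewrite lq_const1//; apply: le_trans (lip0_normP f x y) _.
  by rewrite -[leRHS]mul1r ler_wpM2r// mdist_ge0.
pose w := Weight N2_norm.
have TB x y (e : dual E) : `|e (T x - T y)| <= C * mdist x y * N2 e.
  have -> : e (T x - T y) = delta x0 x y (lip_comp T e) by rewrite linearB.
  apply: le_trans (N12 _ e (molecule_delta x y)) _.
  by rewrite ler_wpM2r// ler_wpM2l// ltW.
have T0 : T x0 = 0 by have /asboolP[] := lip0P T.
have Tw x : T x \in wsub_pred w.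
  by apply/asboolP; exists (C * mdist x x0) => e; rewrite -[T x]subr0 -T0 TB.
pose U0 x : wspace w := WSub (Tw x).
have U0P : U0 \in @lip0_pred R X x0 (wspace w).
  apply/asboolP; split; first exact/val_inj.
  exists C => x y; apply: wsub_norm_le => [|e]; last exact: TB.
  by rewrite mulr_ge0 ?mdist_ge0// ltW.
pose U : lip0 x0 (wspace w) := Lip0 U0P.
have SP : (@wsub_val R E w : wspace w -> E) \in @blin_pred R (wspace w) E.
  apply/asboolP; split; first by move=> c u v; rewrite linearP.
  by exists 1 => v; rewrite mul1r; exact: wsub_val_norm.
pose S : blin (wspace w) E := Blin SP.
exists (wspace w), U, S; split=> //.
(* For a molecule [m], [m (g o U)] is [g] at a vector of G whose image in [E] is the same
   combination of values of [T]; by domination its norm in G is at most [C N1 m]. *)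
- apply: (strictly_summing_of_domination (C := C) (N := N1)) => // m g mm.
  have [sm mE] := molecule_seq mm.
  have gv (H : normedModType R) (V : lip0 x0 H) (h : dual H) :
      m (lip_comp V h) = h (\sum_(a <- sm) a.1 *: (V a.2.1 - V a.2.2)).
    rewrite mE linear_sum; apply: eq_bigr => a _.
    by rewrite linearZ linearB.
  rewrite gv mulrC; apply: le_trans (blin_normP _ _) _; rewrite ler_wpM2l//.
  apply: wsub_norm_le => [|e]; first by rewrite mulr_ge0// ltW.
  have -> : wsub_val (\sum_(a <- sm) a.1 *: (U a.2.1 - U a.2.2)) =
      \sum_(a <- sm) a.1 *: (T a.2.1 - T a.2.2).
    by rewrite linear_sum.
  by rewrite -gv; exact: N12.
(* By the norm of G, [|e (S g)| <= |g| N2 e]; Hoelder and the bound on [N2] give the Cohen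
   inequality with constant 1. *)
- exists 1 => // n g e; rewrite mul1r hoelder_conjugateK.
  apply: (@le_trans _ _ (\sum_(i < n) `|N2 (e i)| * `| `|g i| |)).
    apply: ler_sum => i _; rewrite normr_id (ger0_norm (N20 _)) [leRHS]mulrC.
    exact: (wsub_normP (g i) (e i)).
  apply: le_trans (lq_hoelder_conjugate (fun i => N2 (e i)) (fun i => `|g i|) s1) _.
  by rewrite mulrC ler_wpM2l ?lq_ge0.
Qed.

End factorization.

(** * Compositions are summing: (2) implies (1) *)

Section composition.
Context {R : realType} {X : metricType R} {x0 : X}.

Lemma tens_sum (V W : lmodType R) n (k : 'I_n -> R) (v : 'I_n -> V) (g : W) :
  tens (\sum_(j < n) k j *: v j) g = \sum_(j < n) tens (v j) (k j *: g).
Proof.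
apply/funext => B; rewrite fct_sumE /tens linear_sumlz.
by apply: eq_bigr => j _; rewrite linearZl_LR linearZr.
Qed.

(** Flattens the double families of the (p,r,s)-inequality to the single index used in strict
    r-summability. *)
Lemma big_pair_ord (V : nmodType) n n' (F : 'I_n * 'I_n' -> V) :
  \sum_(k < #|{: 'I_n * 'I_n'}|) F (enum_val k) =
  \sum_(i < n) \sum_(j < n') F (i, j).
Proof.
rewrite pair_bigA/= -(big_enum_val F).
by apply: eq_bigr => -[].
Qed.

Section strictly_summing_bound.
Context {G : normedModType R} (U : lip0 x0 G).
Variables (r C : R) (r1 : 1 <= r).
Variables (n n' : nat) (x y : 'I_n -> 'I_n' -> X) (lam : 'I_n -> 'I_n' -> R).

Let A := sup [set lq r%:E (fun i => \sum_(j < n') lam i j * (f (x i j) - f (y i j)))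
            | f in [set f : lipdual x0 | `|f| <= 1]].

Lemma lip_sup_ub (f : lipdual x0) : `|f| <= 1 ->
  lq r%:E (fun i => \sum_(j < n') lam i j * (f (x i j) - f (y i j))) <= A.
Proof.
have r0 : 0 < r by rewrite (lt_le_trans ltr01).
apply: (@lq_ball_ub R (lipdual x0) r n
  (fun i f => \sum_(j < n') lam i j * (f (x i j) - f (y i j)))
  (fun i => \sum_(j < n') `|lam i j| * mdist (x i j) (y i j))) => // i g.
apply: le_trans (ler_norm_sum _ _ _) _; rewrite mulr_suml; apply: ler_sum => j _.
by rewrite normrM -mulrA ler_wpM2l// mulrC lip0_normP.
Qed.

(** By duality it suffices to pair the norms with [b >= 0]. With [phi i] norming the vector [v i],
    the pairing is the value of [U] on the sum of the [m i (x) b i phi i], whose [dL] is at most [A]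
    times the conjugate norm of [b]. *)
Lemma strictly_summing_strong : 0 < C ->
  (forall l (x y : 'I_l -> X) (gs : 'I_l -> dual G),
    `|\sum_(k < l) gs k (U (x k) - U (y k))| <=
      C * dL r%:E (x0 := x0) (\sum_(k < l) lip_tens (x k) (y k) (gs k))) ->
  lq r%:E (fun i => `|\sum_(j < n') lam i j *: (U (x i j) - U (y i j))|) <= C * A.
Proof.
move=> C0 H; have r0 : 0 < r by rewrite (lt_le_trans ltr01).
have A0 : 0 <= A.
  by apply: le_trans (lip_sup_ub (f := 0) _); rewrite ?lq_ge0// normr0.
apply: lq_dual => // [|b b0]; first by rewrite mulr_ge0// ltW.
pose v i := \sum_(j < n') lam i j *: (U (x i j) - U (y i j)).
have /choice[phi phiP] : forall i, exists phi : dual G,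
    `|phi| <= 1 /\ phi (v i) = `|v i|.
  by move=> i; have [phi] := norming_functional (v i); exists phi.
pose gam i : dual G := b i *: phi i.
pose m i : free_space x0 := \sum_(j < n') lam i j *: free_delta x0 (x i j) (y i j).
pose l := #|{: 'I_n * 'I_n'}|.
pose xs (k : 'I_l) := x (enum_val k).1 (enum_val k).2.
pose ys (k : 'I_l) := y (enum_val k).1 (enum_val k).2.
pose gs (k : 'I_l) : dual G :=
  lam (enum_val k).1 (enum_val k).2 *: gam (enum_val k).1.
have -> : \sum_(i < n) `|v i| * b i = \sum_(k < l) gs k (U (xs k) - U (ys k)).
  rewrite (big_pair_ord (fun ij => (lam ij.1 ij.2 *: gam ij.1 : dual G)
    (U (x ij.1 ij.2) - U (y ij.1 ij.2)))) /=.
  apply: eq_bigr => i _; have [_ <-] := phiP i.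
  rewrite /v linear_sum mulr_suml; apply: eq_bigr => j _ /=.
  rewrite linearZ /= /GRing.scale /=.
  by rewrite mulrAC -mulrA [RHS]mulrC mulrA [RHS]mulrC mulrA.
apply: le_trans (ler_norm _) (le_trans (H l xs ys gs) _).
rewrite -mulrA ler_wpM2l ?(ltW C0)//.
apply: (@le_trans _ _ (weak_lq r%:E m * strong_lq (hoelder_conjugate r%:E) gam)).
  apply: ge_inf.
    exists 0 => _ [l' [x' [y' [gs' [_ [n1 [m1 [hs [_ ->]]]]]]]]].
    by rewrite mulr_ge0 ?lq_ge0 ?weak_lq_ge0.
  exists l, xs, ys, gs; split=> //; exists n, m, gam; split=> //.
  rewrite (big_pair_ord (fun ij => tens (free_delta x0 (x ij.1 ij.2) (y ij.1 ij.2))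
    (lam ij.1 ij.2 *: gam ij.1))).
  by apply: eq_bigr => i _; rewrite tens_sum.
apply: ler_pM; rewrite ?lq_ge0 ?weak_lq_ge0//.
  (* A functional in the unit ball of F(X)^* acts on the [m i] as a Lipschitz function in the unit
     ball of X^#, so the weak norm is at most [A]. *)
  apply: weak_lq_le => Phi Phi1; have [f fPhi fE] := free_dual_lip Phi.
  apply: le_trans (lip_sup_ub (le_trans fPhi Phi1)).
  have -> : (fun i => Phi (m i)) =
      (fun i => \sum_(j < n') lam i j * (f (x i j) - f (y i j))).
    apply/funext => i; rewrite linear_sum; apply: eq_bigr => j _.
    by rewrite linearZ -[RHS](congr1 ( *%R (lam i j)) (fE _ _)).
  exact: lexx.
apply: lq_mono_ereal => [|i].
  by rewrite (lt_le_trans _ (hoelder_conj_ge1 _)) ?lee_fin.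
rewrite normr_id normrZ -[leRHS]mulr1 ler_wpM2l//.
by case: (phiP i).
Qed.

End strictly_summing_bound.

(** The quotients [|e (S g)| / |g|] stand in for the norms of [S^* e]. By duality, test the Cohen
    inequality on the vectors [(b i / |g i|) g i], of norm at most [b i]. Division by zero gives 0,
    so [g i = 0] does no harm. *)
Lemma cohen_summing_strong (G E : normedModType R) (S : blin G E) (s C : R) n
    (g : 'I_n -> G) (e : 'I_n -> dual E) : 1 <= s -> 0 < C ->
  (forall n (x : 'I_n -> G) (ys : 'I_n -> dual E),
    \sum_(i < n) `|ys i (S (x i))| <=
      C * strong_lq (hoelder_conjugate s%:E) x *
        weak_lq (hoelder_conjugate (hoelder_conjugate s%:E)) ys) ->
  lq s%:E (fun i => `|e i (S (g i))| / `|g i|) <= C * weak_lq s%:E e.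
Proof.
move=> s1 C0 H; have s0 : 0 < s by rewrite (lt_le_trans ltr01).
apply: lq_dual => // [|b b0]; first by rewrite mulr_ge0 ?weak_lq_ge0// ltW.
have := H n (fun i => (b i / `|g i|) *: g i) e; rewrite hoelder_conjugateK => h.
have -> : \sum_(i < n) `|e i (S (g i))| / `|g i| * b i =
    \sum_(i < n) `|e i (S ((b i / `|g i|) *: g i))|.
  apply: eq_bigr => i _; rewrite !linearZ.
  rewrite -[RHS]/(`| (b i / `|g i|) * e i (S (g i)) |) normrM.
  rewrite (ger0_norm (divr_ge0 (b0 i) (normr_ge0 _))).
  by rewrite [LHS]mulrC [X in _ * X = _]mulrC mulrA.
apply: le_trans h _; rewrite mulrAC ler_wpM2l ?mulr_ge0 ?weak_lq_ge0 ?(ltW C0)//.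
apply: lq_mono_ereal => [|i].
  by rewrite (lt_le_trans _ (hoelder_conj_ge1 _)) ?lee_fin.
rewrite normr_id normrZ normrM normfV normr_id.
have [->|g0] := eqVneq (g i) 0; first by rewrite normr0 mulr0.
by rewrite divfK// normr_eq0.
Qed.

Lemma composition_prs_summing (G E : normedModType R) (T : lip0 x0 E)
    (U : lip0 x0 G) (S : blin G E) (p r s : R) :
  0 < p -> 1 <= r -> 1 <= s -> p^-1 = r^-1 + s^-1 ->
  strictly_lipschitz_summing r%:E U ->
  cohen_strongly_summing (hoelder_conjugate s%:E) S ->
  T = S \o U :> (X -> E) -> strictly_lipschitz_prs_summing p r s T.
Proof.
move=> p0 r1 s1 prs [C1 C10 H1] [C2 C20 H2] TE.
have r0 : 0 < r by rewrite (lt_le_trans ltr01).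
have s0 : 0 < s by rewrite (lt_le_trans ltr01).
exists (C2 * C1); first exact: mulr_gt0.
move=> n n' _ _ x y lam e.
pose g i := \sum_(j < n') lam i j *: (U (x i j) - U (y i j)).
have -> : (fun i => e i (\sum_(j < n') lam i j *: (T (x i j) - T (y i j)))) =
    (fun i => e i (S (g i))).
  apply/funext => i; congr (e i _); rewrite linear_sum; apply: eq_bigr => j _.
  by rewrite linearZ; congr (_ *: _); rewrite linearB TE.
(* Each term splits as [|g|] times its quotient by [|g|]; Hoelder then separates the contributions
   of [U] and [S]. *)
apply: (@le_trans _ _ (lq p%:E (fun i => `|g i| * (`|e i (S (g i))| / `|g i|)))).
  apply: lq_mono => // i; have [->|g0] := eqVneq (g i) 0.
    by rewrite !linear0 !normr0.
  by rewrite mulrC divfK ?normr_eq0// normr_id.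
apply: le_trans (lq_hoelder _ _ p0 r0 s0 prs) _.
rewrite -[C2 * C1 * _]mulrA [C2 * _]mulrC -mulrA.
apply: ler_pM; rewrite ?lq_ge0//.
  exact: strictly_summing_strong.
exact: cohen_summing_strong.
Qed.

End composition.

Theorem corollary4p6 (R : realType) (p r s : R) (hr : 1 <= r) (hs : 1 <= s)
    (hp : 0 < p) (hprs : p^-1 = r^-1 + s^-1)
    (X : metricType R) (x0 : X) (E : completeNormedModType R)
    (T : lip0 x0 E) :
  strictly_lipschitz_prs_summing p r s T <->
  exists (G : completeNormedModType R) (U : lip0 x0 G) (S : blin G E),
    [/\ strictly_lipschitz_summing r%:E U,
        cohen_strongly_summing (hoelder_conjugate s%:E) S
      & T = S \o U :> (X -> E)].
Proof.
split=> [|[G [U [S [HU HS TE]]]]]; first exact: prs_summing_factors.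
exact: (composition_prs_summing (U := U) (S := S)).
Qed.
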